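(* Let $\Sigma=\mathbb{D}/\Gamma$ be a compact smooth Riemann surface of genus $g\ge 2$, let $\mathcal{G}$ be a finite symmetric set of generators of $\Gamma=\pi_1(\Sigma)$ with $\mathrm{id}\notin\mathcal{G}$, and let $\omega(\alpha)=d_P(0,\alpha(0))$ for $\alpha\in\mathcal{G}$. There exists a constant $K'=K'(\Gamma)$, depending only on the Fuchsian group $\Gamma$ and not on the representation $\rho$ below, such that for every compact metric space $(T,d_T)$ and every representation $\rho\colon\Gamma\to\mathrm{Homeo}(T)$, the distinguished transversal $\mathbb{T}_0$ of the suspension of $\rho$ satisfies \[h(\rho,\mathcal{G},\omega)\le h(\mathbb{T}_0)\le K'\,h(\rho,\mathcal{G},\omega).\]
   Context: Notation: $\mathbb{D}$ is the unit disk, $d_P$ its Poincaré distance, normalized by $d_P(0,\xi)=\log\frac{1+|\xi|}{1-|\xi|}$; $\overline{\mathbb{D}}_R=\{\xi\in\mathbb{D}: d_P(0,\xi)\le R\}$. Suspensions: $\Gamma\subset\mathrm{Aut}(\mathbb{D})$ acts freely on $\mathbb{D}$ by deck transformations, with $\Sigma=\mathbb{D}/\Gamma$. Given a compact metric space $(T,d_T)$ and a homomorphism $\rho\colon\Gamma\to\mathrm{Homeo}(T)$, $\Gamma$ acts on $\mathbb{D}\times T$ by $\gamma\cdot(z,t)=(\gamma\cdot z,\rho(\gamma)(t))$. Put $X=(\mathbb{D}\times T)/\Gamma$ (compact) and write $[\cdot]$ for images in $X$. The suspension of $\rho$ is the lamination of $X$ by the hyperbolic Riemann surfaces (leaves)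 $[\mathbb{D}\times\{t\}]$, $t\in T$; its distinguished transversal is $\mathbb{T}_0=[\{0\}\times T]\simeq T$. Standing assumption: $X$ is embedded in a real manifold $M$ carrying a smooth Riemannian metric $g_M$ which restricts to a Hermitian metric on the leaves, and $d$ is the distance on $X$ induced by $g_M$. Hyperbolic entropy: for $x\in X$, let $L_x$ be the leaf through $x$ and $\phi_x\colon\mathbb{D}\to L_x$ a holomorphic universal covering with $\phi_x(0)=x$ (unique up to a rotation). For $R>0$ let $d_R(x,y)=\inf_{\theta\in\mathbb{R}}\sup_{\xi\in\overline{\mathbb{D}}_R}d(\phi_x(\xi),\phi_y(e^{i\theta}\xi))$ and $B_R(x,\varepsilon)=\{y: d_R(x,y)<\varepsilon\}$. For $Y\subset X$, $N(Y,R,\varepsilon)$ is the minimal number of balls $B_R(x_i,\varepsilon)$, $x_i\in X$, covering $Y$, and $h(Y)=\sup_{\varepsilon>0}\limsup_{R\to+\infty}\frac1R\log N(Y,R,\varepsilon)$. Weighted entropy of $\rho$: $\mathcal{G}$ symmetric means $\mathcal{G}=\mathcal{G}^{-1}$. For $R>0$, $t,s\in T$, let $d_R^{\rho,\mathcal{G},\omega}(t,s)=\sup d_T(\rho(g_1\cdots g_k)(t),\rho(g_1\cdots g_k)(s))$, the sup being over all $k\ge 0$ and $g_1,\dots,g_k\in\mathcal{G}$ with $\sum_{i=1}^k\omega(g_i)\le R$. Let $N(T,R,\varepsilon,\rho,\mathcal{G},\omega)$ be the minimal number of $d_R^{\rho,\mathcal{G},\omega}$-balls of radius $\varepsilon$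 covering $T$, and $h(\rho,\mathcal{G},\omega)=\sup_{\varepsilon>0}\limsup_{R\to+\infty}\frac1R\log N(T,R,\varepsilon,\rho,\mathcal{G},\omega)$.
   Formalization: The constant K' is allowed to depend on the fixed generating set G as well as on Γ (not on T, ρ or the embedding); a K' depending on Γ alone cannot exist, since conjugating G in Γ makes h(ρ,G,ω) arbitrarily small for some ρ while h(T_0)>0 is unchanged. *)

(* Defs.v *)
From HB Require Import structures.
From mathcomp Require Import all_boot all_order all_algebra.
From mathcomp Require Import complex.
From mathcomp Require Import all_classical all_reals all_analysis.

Set Implicit Arguments.
Unset Strict Implicit.
Unset Printing Implicit Defensive.

Import Order.TTheory GRing.Theory Num.Theory.
Import numFieldNormedType.Exports.

Local Open Scope classical_set_scope.
Local Open Scope quotient_scope.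
Local Open Scope ring_scope.

(** * The unit disk and its automorphisms *)

(* [R[i]^o] is [R[i]] with the topology of its norm; [disk R] is then a
   topological space for the induced topology. *)
Definition disk (R : realType) : Type :=
  [set z : R[i]^o | Normc.normc z < 1].
HB.instance Definition _ (R : realType) := Topological.on (disk R).

Definition dval (R : realType) (z : disk R) : R[i] := \val z.

Lemma disk0_subproof (R : realType) :
  (0 : R[i]^o) \in [set z : R[i]^o | Normc.normc z < 1].
Proof. by rewrite inE /= expr0n /= addr0 sqrtr0 ltr01. Qed.

Definition disk0 (R : realType) : disk R := exist (fun z => z \in _) _ (disk0_subproof R).

Definition expi (R : realType) (theta : R) : R[i] := Complex (cos theta) (sin theta).

Lemma rotation_subproof (R : realType) (theta : R) (z : disk R) :
  (expi theta * dval z : R[i]^o) \in [set z : R[i]^o | Normc.normc z < 1].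
Proof.
have /set_mem /= z1 := valP z.
by rewrite inE /= Normc.normcM /= cos2Dsin2 sqrtr1 mul1r.
Qed.

Definition rotation (R : realType) (theta : R) (z : disk R) : disk R :=
  exist (fun w => w \in _) _ (rotation_subproof theta z).

(* Aut(D): the maps z |-> u (z - a) / (1 - conj(a) z) with |u| = 1, |a| < 1. *)
Definition disk_aut (R : realType) (f : disk R -> disk R) : Prop :=
  exists (theta : R) (a : disk R), forall z : disk R,
    dval (f z) =
      expi theta * (dval z - dval a) / (1 - (dval a)^*%C * dval z).

(* The Poincare distance to the origin, d_P(0, z). *)
Definition dP0 (R : realType) (z : disk R) : R :=
  ln ((1 + Normc.normc (dval z)) / (1 - Normc.normc (dval z))).

(** * Groups of deck transformations *)

Definition is_subgroup (T : Type) (H : set (T -> T)) : Prop :=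
  [/\ H idfun,
      forall f g, H f -> H g -> H (f \o g) &
      forall f, H f -> exists2 g, H g & cancel f g /\ cancel g f].

Record aut_subgroup (R : realType) := AutSubgroup {
  agset : set (disk R -> disk R);
  agset_group : is_subgroup agset;
  agset_aut : forall f, agset f -> disk_aut f
}.

(* Gamma acts freely, and every point of the disk has a neighbourhood that is
   disjoint from its translates: z |-> Gamma z is a covering of D / Gamma whose
   deck transformations are the elements of Gamma. *)
Definition deck_action (R : realType) (Gamma : aut_subgroup R) : Prop :=
  (forall f z, agset Gamma f -> f z = z -> f = idfun) /\
  (forall z : disk R, exists2 U, nbhs z U &
     forall f, agset Gamma f -> f <> idfun -> U `&` (f @` U) = set0).

Section surface.
Context (R : realType) (Gamma : aut_subgroup R).

Definition orbit_rel (z w : disk R) : bool :=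
  `[< exists2 f, agset Gamma f & f z = w >].

Lemma orbit_rel_refl : reflexive orbit_rel.
Proof. by move=> z; apply/asboolP; exists idfun => //; case: (agset_group Gamma). Qed.

Lemma orbit_rel_sym : symmetric orbit_rel.
Proof.
have [_ _ Hinv] := agset_group Gamma.
suff H z w : orbit_rel z w -> orbit_rel w z by move=> z w; apply/idP/idP; exact: H.
move=> /asboolP[f Gf <-]; apply/asboolP.
by have [g Gg [fK _]] := Hinv _ Gf; exists g.
Qed.

Lemma orbit_rel_trans : transitive orbit_rel.
Proof.
have [_ Hcomp _] := agset_group Gamma.
move=> w z v /asboolP[f Gf <-] /asboolP[g Gg <-]; apply/asboolP.
by exists (g \o f) => //; exact: Hcomp.
Qed.

Canonical orbit_equiv :=
  EquivRel orbit_rel orbit_rel_refl orbit_rel_sym orbit_rel_trans.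

(* Sigma = D / Gamma *)
Definition surface : topologicalType := quotient_topology {eq_quot orbit_equiv}.

End surface.

Definition commutator_subgroup (T : Type) (H : set (T -> T)) : set (T -> T) :=
  [set h | forall K : set (T -> T), is_subgroup K ->
     (forall f g f' g', H f -> H g -> H f' -> H g' ->
        cancel f f' -> cancel f' f -> cancel g g' -> cancel g' g ->
        K (f' \o g' \o f \o g)) -> K h].

(* The compact surface D / Gamma, whose fundamental group is Gamma, has genus g
   iff its first homology group, the abelianization of Gamma, is Z^(2g). *)
Definition has_genus (R : realType) (Gamma : aut_subgroup R) (g : nat) : Prop :=
  exists ab : (disk R -> disk R) -> 'rV[int]_(g.*2),
    [/\ forall f h, agset Gamma f -> agset Gamma h -> ab (f \o h) = ab f + ab h,
        forall v, exists2 f, agset Gamma f & ab f = v &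
        forall f, agset Gamma f ->
          (ab f = 0 <-> commutator_subgroup (agset Gamma) f)].

(* The product g_1 g_2 ... g_k. *)
Definition word (T : Type) (k : nat) (g : 'I_k -> T -> T) : T -> T :=
  \big[(fun f h => f \o h)/idfun]_(i < k) g i.

Definition symmetric_generators (R : realType) (Gamma : aut_subgroup R)
    (G : set (disk R -> disk R)) : Prop :=
  [/\ finite_set G,
      G `<=` agset Gamma,
      forall f, G f -> exists2 h, G h & cancel f h /\ cancel h f &
      forall f, agset Gamma f ->
        exists (k : nat) (g : 'I_k -> disk R -> disk R),
          (forall i, G (g i)) /\ f = word g].

Definition omega (R : realType) (f : disk R -> disk R) : R := dP0 (f (disk0 R)).

(** * Suspensions *)

Definition is_homeo (T : topologicalType) (f : T -> T) : Prop :=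
  continuous f /\
  exists g : T -> T, [/\ continuous g, cancel f g & cancel g f].

(* Homomorphisms Gamma -> Homeo(T); the values of [rep] outside Gamma are
   irrelevant. *)
Record representation (R : realType) (Gamma : aut_subgroup R)
    (T : topologicalType) := Representation {
  rep :> (disk R -> disk R) -> T -> T;
  rep_homeo : forall f, agset Gamma f -> is_homeo (rep f);
  rep_comp : forall f g, agset Gamma f -> agset Gamma g ->
    rep (f \o g) = rep f \o rep g
}.

Section suspension.
Context (R : realType) (Gamma : aut_subgroup R) (T : topologicalType).
Context (rho : representation Gamma T).

Lemma rep_id : rho idfun = idfun.
Proof.
have [G1 _ _] := agset_group Gamma.
have [_ [g [_ rK _]]] := rep_homeo rho G1.
apply/funext => t; apply: (can_inj rK) => /=.
by have /(congr1 (fun h => h t)) := rep_comp rho G1 G1.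
Qed.

Definition susp_rel (p q : disk R * T) : bool :=
  `[< exists2 f, agset Gamma f & (f p.1, rho f p.2) = q >].

Lemma susp_rel_refl : reflexive susp_rel.
Proof.
case=> z t; apply/asboolP; exists idfun; first by case: (agset_group Gamma).
by rewrite rep_id.
Qed.

Lemma susp_rel_sym : symmetric susp_rel.
Proof.
have [G1 _ Hinv] := agset_group Gamma.
suff H p q : susp_rel p q -> susp_rel q p by move=> p q; apply/idP/idP; exact: H.
move=> /asboolP[f Gf <-]; apply/asboolP.
have [g Gg [fK _]] := Hinv _ Gf; exists g => //=.
have gf1 : g \o f = idfun by apply/funext => z /=; rewrite fK.
have /(congr1 (fun h => h p.2)) /= := rep_comp rho Gg Gf.
by rewrite gf1 rep_id /= => <-; rewrite fK; case: p.
Qed.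

Lemma susp_rel_trans : transitive susp_rel.
Proof.
have [_ Hcomp _] := agset_group Gamma.
move=> q p r /asboolP[f Gf <-] /asboolP[g Gg <-]; apply/asboolP.
by exists (g \o f); [exact: Hcomp|rewrite rep_comp].
Qed.

Canonical susp_equiv :=
  EquivRel susp_rel susp_rel_refl susp_rel_sym susp_rel_trans.

(* X = (D x T) / Gamma *)
Definition suspension : topologicalType :=
  quotient_topology {eq_quot susp_equiv}.

(* The class [z, t]. *)
Definition susp_pt (z : disk R) (t : T) : suspension :=
  \pi_(quotient_topology {eq_quot susp_equiv}) (z, t).

Definition transversal0 : set suspension := range (susp_pt (disk0 R)).

(* The leaf [D x {t}] is the Riemann surface D / Stab(t), with holomorphic
   universal covering z |-> [z, t]; hence a holomorphic universal covering of
   the leaf by D is z |-> [z, t] precomposed with an automorphism of D. *)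
Definition leaf_covering (phi : disk R -> suspension) (x : suspension) : Prop :=
  phi (disk0 R) = x /\
  exists (t : T) (tau : disk R -> disk R),
    disk_aut tau /\ phi = susp_pt^~ t \o tau.

End suspension.

Arguments transversal0 {R Gamma T} rho.
Arguments leaf_covering {R Gamma T rho} phi x.

(** * Smooth manifolds and Riemannian metrics *)

(* All the iterated partial derivatives of f exist and are differentiable on the
   open set U, i.e., f is C^oo on U. *)
Definition smooth_on (R : realType) (m : nat) (V : normedModType R)
    (U : set 'rV[R]_m) (f : 'rV[R]_m -> V) : Prop :=
  forall (s : seq 'I_m) (x : 'rV[R]_m), U x ->
    differentiable
      (foldr (fun i (h : 'rV[R]_m -> V) => 'D_(delta_mx 0 i) h) f s) x.

Record smooth_manifold (R : realType) (n : nat) (M : topologicalType) :=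
  SmoothManifold {
  chart_index : Type;
  chart_dom : chart_index -> set M;
  chart : chart_index -> M -> 'rV[R]_n;
  chart_inv : chart_index -> 'rV[R]_n -> M;
  manifold_hausdorff : hausdorff_space M;
  manifold_second_countable : @second_countable M;
  chart_cover : forall p, exists i, chart_dom i p;
  chart_dom_open : forall i, open (chart_dom i);
  chart_cod_open : forall i, open (chart i @` chart_dom i);
  chartK : forall i p, chart_dom i p -> chart_inv i (chart i p) = p;
  chart_continuous : forall i, {in chart_dom i, continuous (chart i)};
  chart_inv_continuous : forall i,
    {in chart i @` chart_dom i, continuous (chart_inv i)};
  chart_smooth : forall i j,
    smooth_on (chart i @` (chart_dom i `&` chart_dom j))
      (chart j \o chart_inv i)
}.

Definition chart_cod (R : realType) (n : nat) (M : topologicalType)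
    (A : smooth_manifold R n M) (i : chart_index A) : set 'rV[R]_n :=
  chart i @` chart_dom i.

(* [gram i x] is the Gram matrix, in the coordinates of the chart i, of the
   scalar product at the point of coordinates x. *)
Record riemannian_metric (R : realType) (n : nat) (M : topologicalType)
    (A : smooth_manifold R n M) := RiemannianMetric {
  gram : chart_index A -> 'rV[R]_n -> 'M[R]_n;
  gram_sym : forall i x, chart_cod i x -> (gram i x)^T = gram i x;
  gram_posdef : forall i x (v : 'rV[R]_n), chart_cod i x -> v != 0 ->
    0 < (v *m gram i x *m v^T) 0 0;
  gram_smooth : forall i, smooth_on (chart_cod i) (gram i);
  gram_compat : forall i j p (v w : 'rV[R]_n),
    chart_dom i p -> chart_dom j p ->
    v *m gram i (chart i p) *m w^T =
    'd (chart j \o chart_inv i) (chart i p) v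
      *m gram j (chart j p)
      *m ('d (chart j \o chart_inv i) (chart i p) w)^T
}.

Section riemannian_distance.
Context (R : realType) (n : nat) (M : topologicalType).
Context (A : smooth_manifold R n M) (g : riemannian_metric A).

Definition inner (i : chart_index A) (x v w : 'rV[R]_n) : R :=
  (v *m gram g i x *m w^T) 0 0.

(* C^1 arcs parametrized by [0, 1], read in a chart. *)
Definition C1_arc (i : chart_index A) (c : R -> 'rV[R]_n) : Prop :=
  [/\ forall s, s \in `[0, 1] -> chart_cod i (c s),
      forall s, s \in `[0, 1] -> derivable c s 1 &
      {within `[0, 1], continuous (derive1 c)}].

Definition arc_length (i : chart_index A) (c : R -> 'rV[R]_n) : \bar R :=
  (\int[lebesgue_measure]_(s in `[0%R, 1%R])
     (Num.sqrt (inner i (c s) (derive1 c s) (derive1 c s)))%:E)%E.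

(* [path_length p q l]: some piecewise C^1 path from p to q, cut into C^1 arcs
   each of which lies in the domain of a chart, has length l. *)
Inductive path_length : M -> M -> \bar R -> Prop :=
| path_length_nil p : path_length p p 0%E
| path_length_cons (i : chart_index A) (c : R -> 'rV[R]_n) q l :
    C1_arc i c -> path_length (chart_inv i (c 1)) q l ->
    path_length (chart_inv i (c 0)) q (arc_length i c + l)%E.

(* The Riemannian distance; it is +oo between two components of M. *)
Definition riemannian_dist (p q : M) : \bar R :=
  ereal_inf [set l | path_length p q l].

End riemannian_distance.

(** * Embedded suspensions *)

Definition is_embedding (X Y : topologicalType) (f : X -> Y) : Prop :=
  injective f /\
  forall U : set X, open U <-> exists2 V : set Y, open V & U = f @^-1` V.

(* The point x + iy of the disk, for v = (x, y) in the unit disk of R^2. *)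
Definition disk_of_row (R : realType) (v : 'rV[R]_2) : disk R :=
  insubd (disk0 R) (Complex (v 0 0) (v 0 1) : R[i]^o).

Definition row_of_disk (R : realType) (z : disk R) : 'rV[R]_2 :=
  \row_j (if j == 0 then complex.Re (dval z) else complex.Im (dval z)).

Section embedded.
Context (R : realType) (Gamma : aut_subgroup R) (T : topologicalType).
Context (rho : representation Gamma T).
Context (n : nat) (M : topologicalType).
Context (A : smooth_manifold R n M) (g : riemannian_metric A).

(* The leaf [D x {t}], parametrized by v in R^2, |v| < 1, in the chart i. *)
Definition leaf_in_chart (iota : suspension rho -> M) (t : T)
    (i : chart_index A) (v : 'rV[R]_2) : 'rV[R]_n :=
  chart i (iota (susp_pt rho (disk_of_row v) t)).

(* X is embedded in M by [iota], its leaves are smoothly immersed in M, and g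
   induces a Hermitian metric on them: in the coordinate z = x + iy of a leaf, it
   is lambda (dx^2 + dy^2) with lambda > 0. *)
Definition hermitian_embedding (iota : suspension rho -> M) : Prop :=
  is_embedding iota /\
  forall (t : T) (i : chart_index A),
    let F := leaf_in_chart iota t i in
    let W := [set row_of_disk z | z in
                [set z | chart_dom i (iota (susp_pt rho z t))]] in
    smooth_on W F /\
    forall x, W x -> exists2 lambda : R, 0 < lambda &
      forall v w : 'rV[R]_2,
        inner g i (F x) ('d F x v) ('d F x w) = lambda * (v *m w^T) 0 0.

Definition induced_dist (iota : suspension rho -> M) (x y : suspension rho) :
    \bar R :=
  riemannian_dist g (iota x) (iota y).

End embedded.

Arguments hermitian_embedding {R Gamma T rho n M A} g iota.
Arguments induced_dist {R Gamma T rho n M A} g iota x y.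

(** * Entropies *)

(* The minimal number of balls of radius e covering Y, +oo if there is none. *)
Definition covering_number (R : realType) (S : Type) (dist : S -> S -> \bar R)
    (Y : set S) (e : R) : \bar R :=
  ereal_inf [set (k%:R)%:E | k in [set k : nat |
    exists c : 'I_k -> S, Y `<=` \bigcup_i [set y | (dist (c i) y < e%:E)%E]]].

Definition entropy (R : realType) (S : Type) (dist : R -> S -> S -> \bar R)
    (Y : set S) : \bar R :=
  ereal_sup [set
    limf_esup (fun r : R => ((r^-1)%:E * lne (covering_number (dist r) Y e))%E)
      (pinfty_nbhs R)
    | e in [set e : R | 0 < e]].

Definition hyperbolic_dist (R : realType) (X : Type) (d : X -> X -> \bar R)
    (phi : X -> disk R -> X) (r : R) (x y : X) : \bar R :=
  ereal_inf [set
    ereal_sup [set d (phi x xi) (phi y (rotation theta xi))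
               | xi in [set xi : disk R | dP0 xi <= r]]
    | theta in [set: R]].

Definition hyperbolic_entropy (R : realType) (X : Type) (d : X -> X -> \bar R)
    (phi : X -> disk R -> X) (Y : set X) : \bar R :=
  entropy (hyperbolic_dist d phi) Y.

Definition weighted_dist (R : realType) (Gamma : aut_subgroup R)
    (T : metricType R) (rho : representation Gamma T)
    (G : set (disk R -> disk R)) (om : (disk R -> disk R) -> R)
    (r : R) (t s : T) : \bar R :=
  ereal_sup [set l | exists (k : nat) (g : 'I_k -> disk R -> disk R),
    [/\ forall i, G (g i), \sum_(i < k) om (g i) <= r &
        l = (mdist (rho (word g) t) (rho (word g) s))%:E]].

Definition weighted_entropy (R : realType) (Gamma : aut_subgroup R)
    (T : metricType R) (rho : representation Gamma T)
    (G : set (disk R -> disk R)) (om : (disk R -> disk R) -> R) : \bar R :=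
  entropy (weighted_dist rho G om) [set: T].

(* Main.v *)
Require Import Defs.
From mathcomp Require Import all_boot all_order all_algebra.
From mathcomp Require Import complex.
From mathcomp Require Import all_classical all_reals all_analysis.
From mathcomp Require Import ring lra.

(* Two facts about the ambient Riemannian distance suffice: its balls are
   neighbourhoods and form neighbourhood bases. Hence, X being compact, the
   Lebesgue number lemma makes everything uniform.
   Lower bound: if [0, t] and [0, s] lie in the same Bowen ball, then for some
   angle a the points [xi, t] and [e^(ia) xi, s] are close for d_P(0, xi) <= R.
   Projecting to D / Gamma and lifting back along rays, e^(ia) xi stays close to
   xi; taking xi = w^-1(0) for a word w of weight at most R and applying w shows
   that rho(w)(t) and rho(w)(s) are close.
   Upper bound: every xi with d_P(0, xi) <= R is brought back to a fixed compact
   set by a word f of weight at most W (R + 1), and [xi, t] = [f xi, rho(f) t],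
   so that closeness in the weighted metric at scale W (R + 1) implies closeness
   in the Bowen metric at scale R; one may take K' = 2 W. *)

Set Implicit Arguments.
Unset Strict Implicit.
Unset Printing Implicit Defensive.

Import Order.TTheory GRing.Theory Num.Theory.
Import numFieldNormedType.Exports.

Local Open Scope classical_set_scope.
Local Open Scope quotient_scope.
Local Open Scope ring_scope.

(** * Compactness and integral estimates *)

(** The ambient distance [d] sees neither the leaves nor their coordinates, and a Bowen ball may be
    centred off the transversal and allows an arbitrary rotation. The Lebesgue number restores
    coordinates: every [d]-ball of a uniform radius lies in the image of a product box of [D x T],
    so two points close to the same centre have representatives close in both factors, up to
    elements of [Gamma]. Those elements are removed by the injectivity radius, written [6 * eta]:
    the errors met along a ray add up to less than that. Lifting along a ray is done in finitely
    many steps of length [eta], hence without path lifting. On the Riemannian side the delicate fact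
    is that small balls stay inside a given neighbourhood, as the competing paths are free to leave
    the chart; a truncated chart radius is followed along them. The 2 in [2 * W] pays for the
    passage from [r] to [r + 1], since [(r + 1) / r <= 2] once [r >= 1]. *)

Lemma open_setX (X Y : topologicalType) (A : set X) (B : set Y) :
  open A -> open B -> open (A `*` B).
Proof.
move=> oA oB; rewrite (_ : A `*` B = fst @^-1` A `&` snd @^-1` B)//.
by apply: openI; apply: open_comp => // p _; [exact: cvg_fst|exact: cvg_snd].
Qed.

(** Compactness as a near-covering property, applied to the filter of large indices. It turns the
    pointwise constants below (Lebesgue number, word length, injectivity radius, bounds of a
    quadratic form) into uniform ones; monotonicity lets local indices be enlarged. *)
Lemma compact_uniform_index (X : topologicalType) (K : set X)
    (P : nat -> X -> Prop) :
  compact K ->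
  (forall m n x, (m <= n)%N -> P m x -> P n x) ->
  (forall x, K x -> exists m, \forall y \near x, P m y) ->
  exists n, K `<=` P n.
Proof.
move=> /compact_near_coveringP cK Pmono PK.
have [|n _ nP] := cK nat \oo P eventually_filter.
  move=> x /PK[m mP]; near=> y i => /=.
  apply: (Pmono m); first by near: i; exists m.
  by near: y.
by exists n; apply: nP => /=.
Unshelve. all: by end_near. Qed.

(* [d] need not be symmetric. *)
Lemma lebesgue_number (R : realType) (X : topologicalType)
    (d : X -> X -> \bar R) (Y : set X) (V : X -> set X) :
  compact Y ->
  (forall x y z, d x z <= d x y + d y z)%E ->
  (forall x (e : R), 0 < e -> \forall y \near x, (d x y < e%:E)%E) ->
  (forall x, Y x ->
     exists2 e : R, 0 < e & forall y, (d x y < e%:E)%E -> V x y) ->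
  exists2 e : R, 0 < e & forall x, Y x -> exists x0, [/\ Y x0, V x0 x &
    forall y, (d x y < e%:E)%E -> V x0 y].
Proof.
move=> cY dtri dnear VY.
pose P (n : nat) x := exists x0, [/\ Y x0, V x0 x &
    forall y, (d x y < (n.+1%:R^-1)%:E)%E -> V x0 y].
have [||n nP] := @compact_uniform_index X Y P cY.
- move=> m n x mn [x0 [Yx0 Vx Vd]]; exists x0; split => // y yn.
  apply: Vd; apply: lt_le_trans yn _.
  by rewrite lee_fin lef_pV2 ?posrE ?ltr0n// ler_nat ltnS.
- move=> x Yx; have [e e0 eV] := VY _ Yx.
  (* Half of the radius is spent on moving the centre from [x] to [y], the other half on the ball
     around [y]. *)
  have e20 : 0 < e / 2 by rewrite divr_gt0.
  pose m := Num.truncn (e / 2)^-1; exists m.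
  have me : m.+1%:R^-1 <= e / 2.
    by rewrite invf_ple ?posrE ?ltr0n// ltW// truncnS_gt.
  have := dnear x _ e20; apply: filterS => y xy.
  exists x; split => //.
    by apply: eV; apply: lt_trans xy _; rewrite lte_fin ltr_pdivrMr// mulr_natr mulr2n ltrDl.
  move=> z yz; apply: eV; apply: le_lt_trans (dtri _ y _) _.
  rewrite [e]splitr EFinD; apply: lteD => //.
  by apply: lt_le_trans yz _; rewrite lee_fin.
- exists n.+1%:R^-1; first by rewrite invr_gt0 ltr0n.
  by move=> x /nP.
Qed.

(** * Growth bounded by an integral *)

Section comparison_with_integral.
Context (R : realType).
Local Notation mu := (@lebesgue_measure R).

Lemma within_continuous_integrable (k : R -> R) (a b : R) :
  {within `[a, b], continuous k} -> mu.-integrable `[a, b] (EFin \o k).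
Proof. by move=> ck; apply: continuous_compact_integrable => //; exact: segment_compact. Qed.

Lemma within_continuous_subitv (k : R -> R) (a b : R) : 0 <= a -> b <= 1 ->
  {within `[0, 1], continuous k} -> {within `[a, b], continuous k}.
Proof.
move=> a0 b1; apply: continuous_subspaceW => x /=.
by rewrite !in_itv/= => /andP[ax xb]; rewrite (le_trans a0 ax) (le_trans xb b1).
Qed.

Lemma Rintegral_increment_ge (k : R -> R) (s u m : R) :
  0 <= s -> s <= u -> u <= 1 -> {within `[0, 1], continuous k} ->
  (forall v, s <= v <= u -> m <= k v) ->
  (\int[mu]_(v in `[0%R, s]) k v + m * (u - s) <= \int[mu]_(v in `[0%R, u]) k v)%R.
Proof.
move=> s0 su u1 ck mk.
have ik : mu.-integrable `[0, u] (EFin \o k).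
  by apply: within_continuous_integrable; exact: within_continuous_subitv.
have := @Rintegral_itvB _ k (BLeft 0) (BRight u) s ik.
rewrite !bnd_simp => /(_ s0 su) /eqP; rewrite subr_eq => /eqP ->.
rewrite addrC lerD2r Rintegral_itv_obnd_cbnd//; last first.
  by apply: integrableS ik => //; apply: subset_itv; rewrite bnd_simp.
have -> : m * (u - s) = \int[mu]_(v in `[s, u]) (cst m v).
  rewrite Rintegral_cst//= lebesgue_measure_itv/= lte_fin.
  case: ltgtP su => // -> _.
  by rewrite subrr !mulr0.
apply: le_Rintegral => //.
- by apply: within_continuous_integrable => x; exact: cvg_cst.
- by apply: within_continuous_integrable; apply: within_continuous_subitv.
Qed.

(* No regularity of [h] is needed besides the closedness of its sublevel sets:
   the last point at which the bound holds up to [e] is neither isolated in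
   [0, 1[ from the right nor missed. *)
Lemma le_integral_of_local (k h : R -> R) (dl : R) :
  {within `[0, 1], continuous k} ->
  (forall s, s \in `[0, 1] -> 0 <= k s) ->
  (forall s e, s \in `[0, 1] -> h s < dl -> 0 < e ->
     \forall u \near s, u \in `[0, 1] -> h u <= h s + (k s + e) * `|u - s|) ->
  (forall a, a < dl -> closed [set s | s \in `[0, 1] /\ h s <= a]) ->
  h 0 + (\int[mu]_(s in `[0%R, 1%R]) k s)%R < dl ->
  h 1 <= h 0 + (\int[mu]_(s in `[0%R, 1%R]) k s)%R.
Proof.
move=> ck k0 hloc hcl hdl.
pose F s := (\int[mu]_(v in `[0%R, s]) k v)%R.
have FD s u m : 0 <= s -> s <= u -> u <= 1 ->
    (forall v, s <= v <= u -> m <= k v) -> F s + m * (u - s) <= F u.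
  by move=> *; exact: Rintegral_increment_ge.
have Fmono s u : 0 <= s -> s <= u -> u <= 1 -> F s <= F u.
  move=> s0 su u1; have := FD s u 0 s0 su u1; rewrite mul0r addr0; apply.
  move=> v /andP[sv vu]; apply: k0; rewrite in_itv/=.
  by rewrite (le_trans s0 sv) (le_trans vu u1).
apply/ler_addgt0Pr => e' e'0.
(* The slack is also capped so that the bound stays below [dl], the range where [hloc] and [hcl]
   apply. *)
set e := Num.min e' ((dl - (h 0 + F 1)) / 2).
have e0 : 0 < e by rewrite lt_min e'0 divr_gt0// subr_gt0.
have eI : h 0 + F 1 + e < dl.
  have : e <= (dl - (h 0 + F 1)) / 2 by rewrite ge_min lexx orbT.
  by move: hdl; rewrite -/(F 1); lra.
suff : h 1 <= h 0 + F 1 + e * 1.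
  rewrite mulr1 => /le_trans; apply; rewrite lerD2l.
  by rewrite ge_min lexx.
(* Continuous induction: the supremum of [S] is shown to be attained and to equal 1. *)
pose S := [set s : R | 0 <= s <= 1 /\ h s <= h 0 + F s + e * s].
have S0 : S 0.
  split; first by rewrite lexx ler01.
  by rewrite mulr0 addr0 /F set_itv1 Rintegral_set1 addr0.
have hS : has_sup S.
  by split; [exists 0|exists 1 => s [/andP[]]].
set t := sup S.
have tS s : S s -> s <= t by move=> Ss; apply: sup_upper_bound.
have t0 : 0 <= t by exact: tS.
have t1 : t <= 1 by apply: ge_sup => //; [exists 0|move=> s [/andP[]]].
(* Points of [S] lie to the left of [t], so by monotonicity of [F] they satisfy the bound [a] taken
   at [t]; closedness of that sublevel set passes it to the supremum. *)
have St : S t.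
  split; first by rewrite t0 t1.
  set a := (X in _ <= X).
  have adl : a < dl.
    apply: le_lt_trans eI; rewrite /a; apply: lerD; last by rewrite ler_piMr// ltW.
    by rewrite lerD2l Fmono.
  have /= := hcl _ adl t; rewrite closureE/=.
  suff ct : closure [set s | s \in `[0, 1] /\ h s <= a] t.
    by have := hcl _ adl => /closure_id; rewrite predeqE => /(_ t)[_ /(_ ct)[]].
  move=> B /nbhs_ballP[r /= r0 rB].
  have [s Ss ts] := sup_adherent r0 hS.
  have st := tS _ Ss.
  exists s; split.
    case: Ss => /andP[s0 s1] hs; split; first by rewrite in_itv/= s0 s1.
    apply: le_trans hs _; rewrite /a; apply: lerD; last by rewrite ler_pM2l.
    by rewrite lerD2l Fmono.
  by apply: rB; rewrite /ball/= ger0_norm ?subr_ge0// ltrBlDr -ltrBlDl.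
have [t1'|t1'] := ltP t 1; last first.
  have -> : 1 = t by apply/le_anti; rewrite t1' t1.
  by case: St.
exfalso.
have tI : t \in `[0, 1] by rewrite in_itv/= t0 t1.
have htdl : h t < dl.
  case: St => _ /le_lt_trans; apply; apply: le_lt_trans eI.
  apply: lerD; last by rewrite ler_piMr// ltW.
  by rewrite lerD2l Fmono.
(* One half of [e] absorbs the error of [hloc], the other half the variation of [k] to the right of
   [t]. *)
have e20 : 0 < e / 2 by rewrite divr_gt0.
have /nbhs_ballP[r1 /= r10 r1P] := hloc t (e / 2) tI htdl e20.
have kt : \forall u \near t, u \in `[0, 1] -> k t - e / 2 <= k u.
  have /subspace_continuousP/(_ t tI) := ck.
  move=> /cvgrPdist_le/(_ _ e20); rewrite near_withinE.
  apply: filterS => u /= H uI; have := H uI.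
  by rewrite ler_norml => /andP[_]; rewrite lerBlDr [in X in _ -> X]lerBlDl.
move: kt => /nbhs_ballP[r2 /= r20 r2P].
set r := Num.min (Num.min r1 r2 / 2) (1 - t).
have r0 : 0 < r by rewrite lt_min divr_gt0 ?lt_min ?r10 ?r20//= subr_gt0.
have rr12 : r < Num.min r1 r2.
  rewrite gt_min ltr_pdivrMr// mulr_natr mulr2n ltrDl lt_min r10 r20//.
have {rr12}[rr1 rr2] : r < r1 /\ r < r2 by move: rr12; rewrite lt_min => /andP.
have rt : t + r <= 1 by rewrite addrC -lerBrDr ge_min lexx orbT.
have tr0 : 0 <= t + r by rewrite addr_ge0// ltW.
suff : S (t + r) by move=> /tS; rewrite gerDl leNgt r0.
split; first by rewrite tr0 rt.
have ht : h (t + r) <= h t + (k t + e / 2) * r.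
  have := r1P (t + r); rewrite /ball/= opprD addrA subrr sub0r normrN gtr0_norm//.
  rewrite addrAC subrr add0r gtr0_norm//; apply => //.
  by rewrite in_itv/= tr0 rt.
have Ft : F t + (k t - e / 2) * (t + r - t) <= F (t + r).
  apply: FD => //; first by rewrite lerDl ltW.
  move=> v /andP[tv vr]; apply: r2P; last first.
    by rewrite in_itv/= (le_trans t0 tv) (le_trans vr rt).
  by rewrite /ball/= ler0_norm ?subr_le0// opprB ltrBlDr (le_lt_trans vr)// addrC ltrD2r.
case: St => _ hSt.
move: ht Ft hSt; rewrite addrAC subrr add0r; lra.
Qed.

End comparison_with_integral.

(** * The Poincare distance *)

Section hyperbolic_distance.
Context (R : realType).
Local Notation N := (@Normc.normc R).
Implicit Types (z w a : R[i]) (x y : disk R).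

Lemma normc_ge0 z : 0 <= N z.
Proof. by case: z => a b; exact: sqrtr_ge0. Qed.

Lemma normc_conj z : N (z^*)%C = N z.
Proof. by case: z => a b /=; rewrite sqrrN. Qed.

Lemma normcD z w : N (z + w) <= N z + N w.
Proof. exact: le_normcD. Qed.

Lemma normcB z w : N (z - w) = N (w - z).
Proof. by rewrite -normcN opprB. Qed.

Lemma normc_real (r : R) : N (r%:C)%C = `|r|.
Proof. by rewrite /= expr0n addr0 sqrtr_sqr. Qed.

Lemma normc_expi (t : R) : N (expi t) = 1.
Proof. by rewrite /= cos2Dsin2 sqrtr1. Qed.

Lemma mulJc z : z * (z^*)%C = ((N z ^+ 2)%:C)%C.
Proof.
case: z => a b; apply/eqP; rewrite eq_complex /= sqr_sqrtr ?addr_ge0 ?sqr_ge0//.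
by apply/andP; split; apply/eqP; ring.
Qed.

(** The identity behind the nonvanishing of [1 - z^* w] on the disk, the bound 1 on the
    pseudo-hyperbolic distance, and [pseudo_dist_add]. *)
Lemma normc_sub_sqr z w : N (w - z) ^+ 2 =
  N (1 - (z^*)%C * w) ^+ 2 - (1 - N z ^+ 2) * (1 - N w ^+ 2).
Proof.
case: z => a b; case: w => c d.
by rewrite /= !sqr_sqrtr ?addr_ge0 ?sqr_ge0//; ring.
Qed.

Lemma dval_lt1 x : N (dval x) < 1.
Proof. by have /set_mem := valP x. Qed.

Lemma normc_sqr_lt1 z : N z < 1 -> 0 < 1 - N z ^+ 2.
Proof. by move=> z1; rewrite subr_gt0 expr_lt1// normc_ge0. Qed.

Lemma normc_cross_gt0 z w : N z < 1 -> N w < 1 -> 0 < N (1 - (z^*)%C * w).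
Proof.
move=> z1 w1; rewrite lt_neqAle normc_ge0 andbT eq_sym; apply/eqP => H.
have := sqr_ge0 (N (w - z)); rewrite normc_sub_sqr H expr0n sub0r oppr_ge0 leNgt.
by rewrite mulr_gt0// normc_sqr_lt1.
Qed.

Lemma cross_neq0 z w : N z < 1 -> N w < 1 -> 1 - (z^*)%C * w != 0.
Proof.
move=> z1 w1; apply: contraTneq (normc_cross_gt0 z1 w1) => ->.
by rewrite Normc.normc0 ltxx.
Qed.

(* The pseudo-hyperbolic distance [tanh (d_P / 2)]. *)
Definition pseudo_dist z w : R := N (w - z) / N (1 - (z^*)%C * w).

Lemma pseudo_dist_ge0 z w : 0 <= pseudo_dist z w.
Proof. by rewrite divr_ge0 ?normc_ge0. Qed.

Lemma pseudo_dist_lt1 z w : N z < 1 -> N w < 1 -> pseudo_dist z w < 1.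
Proof.
move=> z1 w1; have c0 := normc_cross_gt0 z1 w1.
rewrite ltr_pdivrMr// mul1r -(@ltr_pXn2r _ 2) ?nnegrE ?normc_ge0//.
by rewrite normc_sub_sqr gtrBl mulr_gt0// normc_sqr_lt1.
Qed.

Lemma pseudo_distC z w : pseudo_dist z w = pseudo_dist w z.
Proof.
rewrite /pseudo_dist normcB -[N (1 - _)]normc_conj.
by rewrite rmorphB rmorph1 rmorphM /= conjcK [z * _]mulrC.
Qed.

(** The right-hand side is the value for points in opposite directions. By [normc_sub_sqr] both
    squares have the form [1 - t / c ^+ 2] with the same [t], and the triangle inequality bounds the
    denominator [c] of the left-hand side by [1 + N z * N w]. *)
Lemma pseudo_dist_add z w : N z < 1 -> N w < 1 ->
  pseudo_dist z w <= (N z + N w) / (1 + N z * N w).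
Proof.
move=> z1 w1; have c0 := normc_cross_gt0 z1 w1.
have z0 := normc_ge0 z; have w0 := normc_ge0 w.
have d0 : 0 < 1 + N z * N w by rewrite ltr_pwDl// mulr_ge0.
rewrite -(@ler_pXn2r _ 2) ?nnegrE ?pseudo_dist_ge0 ?divr_ge0 ?addr_ge0 ?(ltW d0)//.
rewrite !expr_div_n normc_sub_sqr.
set c := N _ in c0 *; set r := N z in z1 z0 d0 *; set s := N w in w1 w0 d0 *.
have cd : c <= 1 + r * s.
  rewrite /c; apply: le_trans (normcD _ _) _.
  by rewrite Normc.normc1 lerD2l normcN Normc.normcM normc_conj.
have E : (r + s) ^+ 2 = (1 + r * s) ^+ 2 - (1 - r ^+ 2) * (1 - s ^+ 2) by ring.
have t0 : 0 <= (1 - r ^+ 2) * (1 - s ^+ 2) by rewrite mulr_ge0// ltW// normc_sqr_lt1.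
move: ((1 - r ^+ 2) * (1 - s ^+ 2)) t0 E => t t0 ->.
rewrite !mulrBl !divff ?expf_neq0 ?gt_eqF// lerD2l lerN2 ler_wpM2l//.
by rewrite lef_pV2 ?posrE ?exprn_gt0// ler_pXn2r ?nnegrE ?(ltW c0) ?(ltW d0).
exact: mulr_ge0.
Qed.

(** Twice the inverse hyperbolic tangent, so that [log_ratioD] is the addition formula of [tanh]. *)
Definition log_ratio (p : R) : R := ln ((1 + p) / (1 - p)).

Lemma log_ratio0 : log_ratio 0 = 0.
Proof. by rewrite /log_ratio addr0 subr0 divr1 ln1. Qed.

Lemma log_ratio_pos (p : R) : 0 <= p -> p < 1 -> 0 < (1 + p) / (1 - p).
Proof. by move=> p0 p1; rewrite divr_gt0 ?subr_gt0// ltr_pwDl. Qed.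

Lemma le_log_ratio (p q : R) : 0 <= p -> p <= q -> q < 1 ->
  log_ratio p <= log_ratio q.
Proof.
move=> p0 pq q1; have p1 := le_lt_trans pq q1; have q0 := le_trans p0 pq.
rewrite ler_ln ?posrE ?log_ratio_pos// ler_pdivrMr ?subr_gt0//.
rewrite mulrAC ler_pdivlMr ?subr_gt0//; nra.
Qed.

Lemma log_ratio_ge0 (p : R) : 0 <= p -> p < 1 -> 0 <= log_ratio p.
Proof. by move=> p0 p1; rewrite -log_ratio0; exact: le_log_ratio. Qed.

Lemma log_ratioD (r s : R) : 0 <= r -> r < 1 -> 0 <= s -> s < 1 ->
  log_ratio ((r + s) / (1 + r * s)) = log_ratio r + log_ratio s.
Proof.
move=> r0 r1 s0 s1; rewrite /log_ratio -lnM ?posrE ?log_ratio_pos//; congr ln.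
by field; rewrite !subr_eq0; apply/and4P; split; nra.
Qed.

Definition dP x y : R := log_ratio (pseudo_dist (dval x) (dval y)).

Lemma dP_ge0 x y : 0 <= dP x y.
Proof. by apply: log_ratio_ge0; rewrite ?pseudo_dist_ge0 ?pseudo_dist_lt1 ?dval_lt1. Qed.

Lemma dPC x y : dP x y = dP y x.
Proof. by rewrite /dP pseudo_distC. Qed.

Lemma dPxx x : dP x x = 0.
Proof. by rewrite /dP /pseudo_dist subrr Normc.normc0 mul0r log_ratio0. Qed.

Lemma dval0 : dval (disk0 R) = 0.
Proof. by []. Qed.

Lemma dP0E x : dP0 x = log_ratio (N (dval x)).
Proof. by []. Qed.

Lemma dP0_dP x : dP (disk0 R) x = dP0 x.
Proof.
by rewrite /dP /pseudo_dist dval0 subr0 rmorph0 mul0r subr0 Normc.normc1 divr1.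
Qed.

Lemma dP0_ge0 x : 0 <= dP0 x.
Proof. by rewrite -dP0_dP dP_ge0. Qed.

Lemma disk_of_subproof z : N z < 1 -> z \in [set z : R[i]^o | N z < 1].
Proof. by move=> z1; rewrite inE. Qed.

Definition disk_of z (z1 : N z < 1) : disk R :=
  exist (fun w => w \in [set z : R[i]^o | N z < 1]) _ (disk_of_subproof z1).

Lemma dval_disk_of z (z1 : N z < 1) : dval (disk_of z1) = z.
Proof. by []. Qed.

Lemma disk_eq x y : dval x = dval y -> x = y.
Proof. exact: val_inj. Qed.

Definition mobius_val a z : R[i] := (z - a) / (1 - (a^*)%C * z).

Lemma normc_mobius a z : N (mobius_val a z) = pseudo_dist a z.
Proof. by rewrite Normc.normcM Normc.normcV. Qed.

Lemma mobius_subproof (x y : disk R) : N (mobius_val (dval x) (dval y)) < 1.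
Proof. by rewrite normc_mobius pseudo_dist_lt1 ?dval_lt1. Qed.

Definition mobius x y : disk R := disk_of (mobius_subproof x y).

Lemma dP0_mobius x y : dP0 (mobius x y) = dP x y.
Proof. by rewrite dP0E dval_disk_of normc_mobius. Qed.

Lemma pseudo_dist_unit (u : R[i]) z w : N u = 1 ->
  pseudo_dist (u * z) (u * w) = pseudo_dist z w.
Proof.
move=> u1; rewrite /pseudo_dist -mulrBr Normc.normcM u1 mul1r rmorphM /=.
by rewrite mulrACA [_ * u]mulrC mulJc u1 expr1n mul1r.
Qed.

Lemma pseudo_dist_mobius a z w : N a < 1 -> N z < 1 -> N w < 1 ->
  pseudo_dist (mobius_val a z) (mobius_val a w) = pseudo_dist z w.
Proof.
move=> a1 z1 w1; rewrite /pseudo_dist /mobius_val.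
have A0 := cross_neq0 a1 z1; have B0 := cross_neq0 a1 w1.
have A0' : 1 - a * (z^*)%C != 0.
  by rewrite -conjc_eq0 rmorphB rmorph1 rmorphM /= conjcK.
have zw0 := normc_cross_gt0 z1 w1.
have aa0 : N (1 - (a^*)%C * a) != 0 by rewrite gt_eqF// normc_cross_gt0.
(* Numerator and denominator share the factor [1 - a^* a]; the other extra factors cancel in modulus
   because [1 - a z^*] is the conjugate of [1 - a^* z]. *)
have E1 : (w - a) / (1 - (a^*)%C * w) - (z - a) / (1 - (a^*)%C * z) =
    (w - z) * (1 - (a^*)%C * a) / ((1 - (a^*)%C * w) * (1 - (a^*)%C * z)).
  by field; rewrite A0 B0.
have E2 : 1 - (((z - a) / (1 - (a^*)%C * z))^*)%C * ((w - a) / (1 - (a^*)%C * w)) =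
    (1 - (a^*)%C * a) * (1 - (z^*)%C * w) / ((1 - a * (z^*)%C) * (1 - (a^*)%C * w)).
  rewrite fmorph_div /= !rmorphB rmorph1 !rmorphM /= conjcK.
  by field; rewrite A0' B0.
rewrite E1 E2 !(Normc.normcM, Normc.normcV).
have -> : N (1 - a * (z^*)%C) = N (1 - (a^*)%C * z).
  by rewrite -normc_conj rmorphB rmorph1 rmorphM /= conjcK.
have A0n : N (1 - (a^*)%C * z) != 0 by rewrite gt_eqF// normc_cross_gt0.
have B0n : N (1 - (a^*)%C * w) != 0 by rewrite gt_eqF// normc_cross_gt0.
have Z0n : N (1 - (z^*)%C * w) != 0 by rewrite gt_eqF.
by field; rewrite A0n B0n aa0 Z0n.
Qed.

Lemma dP_mobius x' x y : dP (mobius x' x) (mobius x' y) = dP x y.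
Proof. by rewrite /dP !dval_disk_of pseudo_dist_mobius ?dval_lt1. Qed.

Lemma dP_rotation (t : R) x y : dP (rotation t x) (rotation t y) = dP x y.
Proof. by rewrite /dP pseudo_dist_unit// normc_expi. Qed.

Lemma disk_autE (f : disk R -> disk R) : disk_aut f ->
  exists (t : R) (a : disk R), f = rotation t \o mobius a.
Proof.
move=> [t [a fE]]; exists t, a; apply/funext => x; apply: disk_eq.
by rewrite fE -mulrA.
Qed.

Lemma dP_aut (f : disk R -> disk R) x y : disk_aut f -> dP (f x) (f y) = dP x y.
Proof. by move=> /disk_autE[t [a ->]]; rewrite dP_rotation dP_mobius. Qed.

Lemma dP_rotation0 (t : R) x : dP0 (rotation t x) = dP0 x.
Proof. by rewrite !dP0E /= Normc.normcM normc_expi mul1r. Qed.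

Lemma dP_le_dP0 x y : dP x y <= dP0 x + dP0 y.
Proof.
rewrite !dP0E -log_ratioD ?normc_ge0 ?dval_lt1//.
have x0 := normc_ge0 (dval x); have y0 := normc_ge0 (dval y).
have x1 := dval_lt1 x; have y1 := dval_lt1 y.
apply: le_log_ratio; rewrite ?pseudo_dist_ge0 ?pseudo_dist_add//.
rewrite ltr_pdivrMr ?mul1r; nra.
Qed.

(** Invariance allows [y] to be moved to the origin, where [dP_le_dP0] is the claim. *)
Lemma dP_triangle y x x' : dP x x' <= dP x y + dP y x'.
Proof.
rewrite -(dP_mobius y x x') (dPC x y) -(dP0_mobius y x) -(dP0_mobius y x').
exact: dP_le_dP0.
Qed.

Lemma dval_rotation (t : R) x : dval (rotation t x) = expi t * dval x.
Proof. by []. Qed.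

Lemma rotationD (t t' : R) x : rotation t (rotation t' x) = rotation (t + t') x.
Proof.
apply: disk_eq; rewrite !dval_rotation mulrA; congr (_ * _).
apply/eqP; rewrite eq_complex /= cosD sinD; apply/andP; split => //.
by apply/eqP; ring.
Qed.

Lemma rotation0 x : rotation 0 x = x.
Proof. by apply: disk_eq; rewrite dval_rotation /expi cos0 sin0 mul1r. Qed.

(** The geodesic from [x] to the origin, followed over a length [h]; the maximum covers the case
    where it stops at the origin. Rays enter the later arguments only in this form. *)
Lemma radial_step x (h : R) : 0 <= h ->
  exists y, dP0 y <= Num.max 0 (dP0 x - h) /\ dP y x <= h.
Proof.
rewrite le_eqVlt => /predU1P[<-|h0].
  by exists x; rewrite subr0 dPxx le_max lexx orbT.
have [xh|xh] := leP (dP0 x) h.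
  by exists (disk0 R); rewrite dP0_dP -dP0_dP dPxx le_max lexx.
set r := N (dval x); have r0 : 0 <= r := normc_ge0 _.
have r1 : r < 1 := dval_lt1 x.
(* [q] is [expR (dP0 x - h)], and [s] below solves [(1 + s) / (1 - s) = q]: it is the radius at
   which [dP0] has dropped by [h]. *)
set q := (1 + r) / (1 - r) * expR (- h).
have lnq : ln q = dP0 x - h.
  by rewrite lnM ?posrE ?log_ratio_pos ?expR_gt0// expRK.
have q0 : 0 < q by rewrite mulr_gt0 ?log_ratio_pos ?expR_gt0.
have q1 : 1 < q.
  by rewrite -ltr_ln ?posrE// ln1 lnq subr_gt0.
have r_gt0 : 0 < r.
  rewrite lt_neqAle r0 andbT; apply: contraTneq xh => r00.
  by rewrite dP0E -/r -r00 log_ratio0 -leNgt ltW.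
pose s := (q - 1) / (q + 1).
have s0 : 0 <= s by rewrite divr_ge0; lra.
have s1 : s < 1 by rewrite ltr_pdivrMr; lra.
have ls : log_ratio s = dP0 x - h.
  rewrite -lnq /log_ratio; congr ln; rewrite /s; field; lra.
have sr : s <= r.
  rewrite leNgt; apply/negP => rs; have := le_log_ratio r0 (ltW rs) s1.
  by rewrite ls dP0E -/r => H; move: h0; rewrite ltNge; case/negP; lra.
pose c := s / r.
have c0 : 0 <= c by rewrite divr_ge0.
have cr : c * r = s by rewrite /c divfK// gt_eqF.
have y1 : N ((c%:C)%C * dval x) < 1.
  by rewrite Normc.normcM normc_real ger0_norm// cr.
exists (disk_of y1).
have -> : dP0 (disk_of y1) = dP0 x - h.
  by rewrite dP0E dval_disk_of Normc.normcM normc_real ger0_norm// cr.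
split; first by rewrite le_max lexx orbT.
have c1 : c <= 1 by rewrite ler_pdivrMr ?mul1r.
have rs1 : 0 < 1 - s * r by rewrite subr_gt0; nra.
have pE : pseudo_dist ((c%:C)%C * dval x) (dval x) = (r - s) / (1 - s * r).
  rewrite /pseudo_dist; congr (_ / _).
    rewrite -[X in X - _]mul1r -mulrBl Normc.normcM.
    rewrite (_ : 1 - (c%:C)%C = ((1 - c)%:C)%C); last by rewrite rmorphB rmorph1.
    by rewrite normc_real ger0_norm ?subr_ge0// mulrBl mul1r cr.
  have -> : (((c%:C)%C * dval x)^*)%C = (c%:C)%C * ((dval x)^*)%C.
    by rewrite rmorphM; congr (_ * _); exact: conjc_real.
  rewrite -mulrA [_ * dval x]mulrC mulJc -rmorphM.
  rewrite -/r expr2 mulrA cr (_ : 1 - ((s * r)%:C)%C = ((1 - s * r)%:C)%C).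
    by rewrite normc_real gtr0_norm.
  by rewrite rmorphB rmorph1.
have p0 : 0 <= (r - s) / (1 - s * r) by rewrite divr_ge0 ?(ltW rs1)// subr_ge0.
have p1 : (r - s) / (1 - s * r) < 1.
  rewrite ltr_pdivrMr// mul1r; have : 0 <= s * (1 - r) by rewrite mulr_ge0// subr_ge0 ltW.
  by rewrite mulrBr mulr1; lra.
(* The [tanh] sum of [s] and [(r - s) / (1 - s * r)] is [r], so the distance from the new point to
   [x] is the difference of their distances to the origin, that is [h]. *)
have := log_ratioD s0 s1 p0 p1.
rewrite (_ : _ / _ = r); last first.
  have ss1 : 0 < 1 - s ^+ 2 by rewrite subr_gt0 expr_lt1.
  field; rewrite gt_eqF//= gt_eqF//; move: ss1; congr (_ < _); ring.
rewrite /dP dval_disk_of pE ls dP0E -/r; lra.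
Qed.

Lemma log_ratio_onto (h : R) : 0 < h -> exists p, 0 < p < 1 /\ log_ratio p = h.
Proof.
move=> h0; have e1 : 1 < expR h by rewrite expR_gt1.
exists ((expR h - 1) / (expR h + 1)); split.
  by rewrite divr_gt0 ?ltr_pdivrMr; lra.
rewrite /log_ratio -[RHS]expRK; congr ln.
by field; lra.
Qed.

Lemma lt_of_log_ratio (p q : R) : 0 <= p -> p < 1 -> 0 <= q ->
  log_ratio p < log_ratio q -> p < q.
Proof.
move=> p0 p1 q0; rewrite !ltNge; apply: contra => qp.
exact: le_log_ratio.
Qed.

Lemma disk_nbhs_normcP x (U : set (disk R)) :
  nbhs x U <-> exists2 r : R, 0 < r & forall y, N (dval y - dval x) < r -> U y.
Proof.
split.
  case=> V [[W oW <-] Wx sWU].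
  have : nbhs (dval x : R[i]^o) W by apply: open_nbhs_nbhs.
  (* Balls of [R[i]] have complex radii; positivity of such a radius makes its imaginary part
     vanish. *)
  move=> /nbhs_ballP[[e e'] /= /andP[/eqP/= -> e0] eW].
  exists e => // y ye; apply: sWU; apply: eW.
  rewrite -ball_normE /ball_/= distrC.
  by rewrite -[X in X < _]/((N (dval y - dval x))%:C)%C ltcR.
move=> [r r0 rU]; pose B := (ball (dval x : R[i]^o) (r%:C)%C).
have rC : 0 < (r%:C)%C by rewrite ltcR.
exists (set_val @^-1` B^°); split.
- by exists B^°; [exact: open_interior|].
- exact: (nbhsx_ballx _ _ rC).
- move=> y /= /interior_subset; rewrite /B -ball_normE /ball_/= distrC.
  by rewrite -[X in X < _]/((N (dval y - dval x))%:C)%C ltcR => /rU.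
Qed.

Lemma normc_cross_le2 z w : N z < 1 -> N w < 1 -> N (1 - (z^*)%C * w) <= 2.
Proof.
move=> z1 w1; apply: le_trans (normcD _ _) _.
rewrite Normc.normc1 normcN Normc.normcM normc_conj.
by have := normc_ge0 z; have := normc_ge0 w; nra.
Qed.

Lemma normc_cross_ge z w : N w < 1 -> 1 - N z <= N (1 - (z^*)%C * w).
Proof.
move=> w1; have := normcD (1 - (z^*)%C * w) ((z^*)%C * w).
rewrite subrK Normc.normc1 Normc.normcM normc_conj.
by have := normc_ge0 z; have := normc_ge0 w; nra.
Qed.

(** The denominator of [pseudo_dist] lies between [1 - N (dval x)] and 2, so near [x] the
    pseudo-hyperbolic and the Euclidean distances are comparable. *)
Lemma disk_nbhsP x (U : set (disk R)) :
  nbhs x U <-> exists2 r : R, 0 < r & forall y, dP x y < r -> U y.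
Proof.
have x1 := dval_lt1 x.
split.
  move=> /disk_nbhs_normcP[r r0 rU].
  pose p : R := Num.min (r / 2) (1 / 2).
  have p0 : 0 < p by rewrite lt_min !divr_gt0.
  have p1 : p < 1 by rewrite gt_min; apply/orP; right; lra.
  exists (log_ratio p).
    by rewrite ln_gt0// ltr_pdivlMr; lra.
  move=> y; have y1 := dval_lt1 y => yp; apply: rU.
  have {}yp := lt_of_log_ratio (pseudo_dist_ge0 _ _) (pseudo_dist_lt1 x1 y1) (ltW p0) yp.
  move: yp; rewrite ltr_pdivrMr ?normc_cross_gt0// => /lt_le_trans; apply.
  have pr : p <= r / 2 by rewrite ge_min lexx.
  apply: (@le_trans _ _ (p * 2)); last by lra.
  by rewrite ler_pM2l// normc_cross_le2.
move=> [r r0 rU]; have r20 : 0 < r / 2 by rewrite divr_gt0.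
have [p [/andP[p0 p1] pr]] := log_ratio_onto r20.
apply/disk_nbhs_normcP; exists (p * (1 - N (dval x))); first by rewrite mulr_gt0 ?subr_gt0.
move=> y xy; have y1 := dval_lt1 y; apply: rU.
apply: (@le_lt_trans _ _ (r / 2)); last by rewrite ltr_pdivrMr//; lra.
rewrite -pr; apply: le_log_ratio => //; first exact: pseudo_dist_ge0.
rewrite ler_pdivrMr ?normc_cross_gt0//; apply/ltW/(lt_le_trans xy).
by rewrite ler_pM2l// normc_cross_ge.
Qed.

Lemma dP_ball_open x (r : R) : open [set y | dP x y < r].
Proof.
rewrite openE => y /= xy; apply/disk_nbhsP; exists (r - dP x y); first by rewrite subr_gt0.
by move=> z; rewrite ltrBrDl; apply: le_lt_trans; exact: dP_triangle.
Qed.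

Lemma disk_aut_continuous (f : disk R -> disk R) : disk_aut f -> continuous f.
Proof.
move=> fa x U /disk_nbhsP[r r0 rU]; apply/disk_nbhsP; exists r => // y xy.
by apply: rU; rewrite dP_aut.
Qed.

(** * Compactness of hyperbolic balls *)

Definition plane_norm (v : R * R) : R := Num.sqrt (1 + v.1 ^+ 2 + v.2 ^+ 2).

Lemma plane_norm_gt0 v : 0 < plane_norm v.
Proof. by rewrite sqrtr_gt0 -addrA ltr_pwDl// addr_ge0 ?sqr_ge0. Qed.

(** The map [v / sqrt (1 + |v|^2)], with inverse [x / sqrt (1 - |x|^2)] on the disk. Through it,
    compact squares of the plane give compact subsets of the disk. *)
Definition plane_to_disk_val (v : R * R) : R[i] :=
  ((v.1 / plane_norm v) +i* (v.2 / plane_norm v))%C.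

Lemma plane_to_disk_subproof v : N (plane_to_disk_val v) < 1.
Proof.
have n0 := plane_norm_gt0 v.
rewrite -(@ltr_pXn2r _ 2) ?nnegrE ?normc_ge0// expr1n /=.
rewrite sqr_sqrtr ?addr_ge0 ?sqr_ge0// !expr_div_n -mulrDl ltr_pdivrMr ?exprn_gt0//.
rewrite mul1r sqr_sqrtr; last by rewrite -addrA addr_ge0// addr_ge0 ?sqr_ge0.
by rewrite -addrA ltrDr.
Qed.

Definition plane_to_disk v : disk R := disk_of (plane_to_disk_subproof v).

Lemma normc_le_ReIm z : N z <= `|complex.Re z| + `|complex.Im z|.
Proof.
case: z => a b /=; rewrite -(@ler_pXn2r _ 2) ?nnegrE ?sqrtr_ge0 ?addr_ge0//.
rewrite sqr_sqrtr ?addr_ge0 ?sqr_ge0// sqrrD !real_normK ?num_real//.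
by rewrite lerD2r lerDl mulrn_wge0 ?mulr_ge0.
Qed.

Lemma plane_norm_continuous : continuous plane_norm.
Proof.
move=> v; apply: (@continuous_comp _ _ _ (fun w : R * R => 1 + w.1 ^+ 2 + w.2 ^+ 2)).
  apply: cvgD; first apply: cvgD; first exact: cvg_cst.
  - by apply: (cvg_comp _ (fun t => t ^+ 2) cvg_fst); exact: exprn_continuous.
  - by apply: (cvg_comp _ (fun t => t ^+ 2) cvg_snd); exact: exprn_continuous.
exact: sqrt_continuous.
Qed.

Lemma plane_to_disk_continuous : continuous plane_to_disk.
Proof.
move=> v U /disk_nbhs_normcP[r r0 rU].
have n0 : plane_norm v != 0 by rewrite gt_eqF// plane_norm_gt0.
have c1 : (fun w : R * R => w.1 / plane_norm w) @ v --> v.1 / plane_norm v.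
  by apply: cvgM; [exact: cvg_fst|apply: cvgV => //; exact: plane_norm_continuous].
have c2 : (fun w : R * R => w.2 / plane_norm w) @ v --> v.2 / plane_norm v.
  by apply: cvgM; [exact: cvg_snd|apply: cvgV => //; exact: plane_norm_continuous].
have r20 : 0 < r / 2 by rewrite divr_gt0.
have /cvgrPdist_lt/(_ _ r20) h1 := c1.
have /cvgrPdist_lt/(_ _ r20) h2 := c2.
suff : \forall w \near v, U (plane_to_disk w) by [].
move: h1 h2; apply: filterS2 => w h1 h2; apply: rU; rewrite !dval_disk_of.
apply: le_lt_trans (normc_le_ReIm _) _; rewrite [r]splitr.
by apply: ltrD; rewrite /= distrC.
Qed.

Lemma dP0_ball_precompact (D : R) :
  exists2 K : set (disk R), compact K & forall x, dP0 x <= D -> K x.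
Proof.
(* The maximum and the added 1 make the radius positive for every real [D], as [log_ratio_onto]
   requires, and larger than [D]. *)
have D0 : 0 < Num.max D 0 + 1 by rewrite ltr_wpDl// le_max lexx orbT.
have [r [/andP[r0 r1] rD]] := log_ratio_onto D0.
have rr : 0 < 1 - r ^+ 2 by rewrite subr_gt0 expr_lt1// ltW.
pose L := (Num.sqrt (1 - r ^+ 2))^-1.
exists (plane_to_disk @` (`[- L, L] `*` `[- L, L])).
  apply: continuous_compact.
    by apply: continuous_subspaceT; exact: plane_to_disk_continuous.
  by apply: compact_setX; exact: segment_compact.
move=> x xD; have x0 := normc_ge0 (dval x); have x1 := dval_lt1 x.
have xr : N (dval x) < r.
  apply: lt_of_log_ratio => //; first exact: ltW.
  rewrite rD -dP0E (le_lt_trans xD)// (@le_lt_trans _ _ (Num.max D 0)) ?ltrDl//.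
  by rewrite le_max lexx.
set n := N (dval x) in x0 x1 xr.
have nn : 0 < 1 - n ^+ 2 by exact: normc_sqr_lt1.
pose m := Num.sqrt (1 - n ^+ 2).
have m0 : 0 < m by rewrite sqrtr_gt0.
have m2 : m ^+ 2 = 1 - n ^+ 2 by rewrite sqr_sqrtr// ltW.
have mL : m^-1 <= L.
  rewrite lef_pV2 ?posrE ?sqrtr_gt0// ler_wsqrtr// lerD2l lerN2.
  by rewrite ler_pXn2r ?nnegrE// ltW.
pose a := complex.Re (dval x); pose b := complex.Im (dval x).
have n2 : n ^+ 2 = a ^+ 2 + b ^+ 2.
  rewrite /n /a /b; case: (dval x) => u v /=.
  by rewrite sqr_sqrtr ?addr_ge0 ?sqr_ge0.
have pn : plane_norm (a / m, b / m) = m^-1.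
  rewrite /plane_norm /= (_ : 1 + _ + _ = m^-1 ^+ 2) ?sqrtr_sqr ?gtr0_norm ?invr_gt0//.
  rewrite !expr_div_n -addrA -mulrDl -n2 -[1](@divff _ (m ^+ 2)) ?expf_neq0 ?gt_eqF//.
  by rewrite -mulrDl {1}m2 subrK mul1r exprVn.
have coordL (c : R) : c ^+ 2 <= n ^+ 2 -> c / m \in `[- L, L].
  move=> cn; rewrite in_itv/= -ler_norml normrM normfV (gtr0_norm m0).
  apply: le_trans mL; rewrite ler_piMl ?invr_ge0 ?(ltW m0)//.
  rewrite -(@ler_pXn2r _ 2) ?nnegrE// expr1n real_normK ?num_real//.
  by apply: le_trans cn _; rewrite ltW// -subr_gt0.
exists (a / m, b / m).
  by split; apply: coordL; rewrite n2 ?lerDl ?lerDr sqr_ge0.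
apply: disk_eq; rewrite dval_disk_of /plane_to_disk_val pn /= invrK !divfK ?gt_eqF//.
by rewrite /a /b; case: (dval x).
Qed.

(** A case of the Schwarz lemma, by computation: the zero [b] of [f] must be [h 0 = - expi s * a],
    after which the two fractions cancel up to a unit constant. *)
Lemma disk_aut_comp_fix0 (f h : disk R -> disk R) : disk_aut f -> disk_aut h ->
  f (h (disk0 R)) = disk0 R -> exists t, forall x, f (h x) = rotation t x.
Proof.
move=> [t [b fE]] [s [a hE]] fh0; exists (t + s) => x; apply: disk_eq.
rewrite -rotationD !dval_rotation.
have b1 := dval_lt1 b; have a1 := dval_lt1 a; have x1 := dval_lt1 x.
have us : expi s * ((expi s)^*)%C = 1 by rewrite mulJc normc_expi expr1n.
have bE : dval b = - (expi s * dval a).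
  have := congr1 (fun y => N (dval y)) fh0.
  rewrite fE Normc.normcM Normc.normcV Normc.normcM normc_expi mul1r dval0 Normc.normc0.
  have h1 := dval_lt1 (h (disk0 R)).
  move/eqP; rewrite mulf_eq0 invr_eq0 [X in _ || X]gt_eqF ?normc_cross_gt0// orbF.
  move=> /eqP/Normc.eq0_normc/eqP; rewrite subr_eq0 => /eqP <-.
  by rewrite hE dval0 mulr0 subr0 divr1 sub0r mulrN.
have A0 := cross_neq0 a1 x1; have A1 := cross_neq0 a1 a1.
rewrite fE hE bE rmorphN rmorphM /=.
have -> : 1 - - (((expi s)^*)%C * ((dval a)^*)%C) *
    (expi s * (dval x - dval a) / (1 - ((dval a)^*)%C * dval x)) =
    (1 - ((dval a)^*)%C * dval a) / (1 - ((dval a)^*)%C * dval x).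
  apply: (@eq_trans _ _ (1 + (expi s * ((expi s)^*)%C) * (((dval a)^*)%C *
     (dval x - dval a)) / (1 - ((dval a)^*)%C * dval x))); first by field.
  by rewrite us; field.
by field; rewrite A0 A1.
Qed.

End hyperbolic_distance.

(** * The topology of a Riemannian distance *)

(** Provides the local growth hypothesis of [le_integral_of_local] for curves read in a chart. *)
Lemma derivable_local_growth (R : realType) (V : normedModType R) (e : R -> V)
    (s eps : R) : derivable e s 1 -> 0 < eps ->
  \forall u \near s, `|e u - e s| <= (`|derive1 e s| + eps) * `|u - s|.
Proof.
move=> /derivable_nbhs/eqaddoP/(_ _)/[swap] eps0 /(_ _ eps0).
move=> /nbhs_ballP[r /= r0 rP]; apply/nbhs_ballP; exists r => // u us.
have := rP (u - s); rewrite /ball/= sub0r normrN distrC => /(_ us); rewrite [`|s - u|]distrC.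
rewrite -derive1E !fctE /= opprD addrA [X in e X](_ : _ = u); last first.
  by rewrite /GRing.scale/= mulr1 subrK.
move=> H; rewrite mulrDl [`|derive1 e s| * _]mulrC -normrZ.
apply: (@le_trans _ _ (`|(u - s) *: derive1 e s| +
    `|e u - e s - (u - s) *: derive1 e s|)); last by rewrite lerD2l.
by rewrite -{1}(subrK ((u - s) *: derive1 e s) (e u - e s)) addrC ler_normD.
Qed.

Section quadratic_forms.
Context (R : realType) (n : nat).
Implicit Types (Q : 'M[R]_n) (u v : 'rV[R]_n).

Lemma cvg_quadratic_form (I : Type) (F : set_system I) {FF : Filter F}
    (Q : I -> 'M[R]_n) (u v : I -> 'rV[R]_n) (Q0 : 'M[R]_n) (u0 v0 : 'rV[R]_n) :
  Q @ F --> Q0 -> u @ F --> u0 -> v @ F --> v0 ->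
  (fun i => (u i *m Q i *m (v i)^T) 0 0) @ F --> (u0 *m Q0 *m v0^T) 0 0.
Proof.
move=> cQ cu cv.
have E (Q1 : 'M[R]_n) (u1 v1 : 'rV[R]_n) : (u1 *m Q1 *m v1^T) 0 0 =
    \sum_j (\sum_k u1 0 k * Q1 k j) * v1 0 j.
  by rewrite mxE; apply: eq_bigr => j _; rewrite !mxE.
have cvg_coord p q (w : I -> 'M[R]_(p, q)) (w0 : 'M[R]_(p, q)) i j : w @ F --> w0 ->
    (fun x => w x i j) @ F --> w0 i j.
  by move=> cw; exact: cvg_comp cw (@coord_continuous R p q i j w0).
under eq_fun do rewrite E.
have addC : continuous (fun z : R * R => z.1 + z.2).
  by move=> z; exact: cvgD cvg_fst cvg_snd.
rewrite E; apply: cvg_big => // j _.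
apply: cvgM; last exact: cvg_coord.
by apply: cvg_big => // k _; apply: cvgM; exact: cvg_coord.
Qed.

Lemma quadratic_formZ Q v (a : R) :
  ((a *: v) *m Q *m (a *: v)^T) 0 0 = a ^+ 2 * (v *m Q *m v^T) 0 0.
Proof. by rewrite linearZ/= -scalemxAr -!scalemxAl !mxE mulrA -expr2. Qed.

Lemma compact_unit_sphere : compact [set v : 'rV[R]_n | `|v| = 1].
Proof.
apply: bounded_closed_compact.
  by exists 1; split => // M M1 v /= ->; exact: ltW.
rewrite (_ : [set _ | _] = Num.norm @^-1` [set 1 : R])//.
by apply: preimage_closed => [v _|]; [exact: norm_continuous|exact: closed_eq].
Qed.

(** Both bounds hold on the unit sphere by compactness, uniformly for base points near [x0], and
    extend to all vectors by homogeneity. *)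
Lemma quadratic_form_local_bounds (Q : 'rV[R]_n -> 'M[R]_n) (x0 : 'rV[R]_n) :
  {for x0, continuous Q} ->
  (forall v, v != 0 -> 0 < (v *m Q x0 *m v^T) 0 0) ->
  exists c C dl : R, [/\ 0 < c, 0 < C, 0 < dl & forall x, `|x - x0| < dl ->
    forall v, c * `|v| <= Num.sqrt ((v *m Q x *m v^T) 0 0) <= C * `|v|].
Proof.
move=> cQ posQ.
(* One integer controls the radius, the lower bound and the upper bound at once, which makes the
   property monotone in it. *)
pose P m v := forall x, `|x - x0| < m.+1%:R^-1 ->
  m.+1%:R^-1 < (v *m Q x *m v^T) 0 0 < m.+1%:R.
have [||m mP] := compact_uniform_index (P := P) compact_unit_sphere.
- move=> m p v mp Pv x xp.
  have pm : p.+1%:R^-1 <= m.+1%:R^-1 :> R.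
    by rewrite lef_pV2 ?posrE ?ltr0n// ler_nat ltnS.
  have /andP[lo up] := Pv x (lt_le_trans xp pm).
  by rewrite (le_lt_trans pm lo) (lt_le_trans up)// ler_nat ltnS.
- move=> v /= v1.
  have v0 : v != 0 by rewrite -normr_eq0 v1 oner_eq0.
  set q := (v *m Q x0 *m v^T) 0 0.
  have q0 : 0 < q by exact: posQ.
  have cq : (fun z : 'rV[R]_n * 'rV[R]_n => (z.1 *m Q z.2 *m z.1^T) 0 0)
      @ nbhs (v, x0) --> q.
    apply: cvg_quadratic_form; [|exact: cvg_fst|exact: cvg_fst].
    by apply: (cvg_comp _ _ cvg_snd).
  have : \forall z \near (v, x0), q / 2 < (z.1 *m Q z.2 *m z.1^T) 0 0 < q + 1.
    near=> z; apply/andP; split; near: z.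
      by apply: (cvgr_gt _ cq); rewrite ltr_pdivrMr// mulr_natr mulr2n ltrDl.
    by apply: (cvgr_lt _ cq); rewrite ltrDl.
  case=> -[U W] /= [Uv /nbhs_ballP[r /= r0 rW] UW].
  set b := Num.max (Num.max (q / 2)^-1 (q + 1)) r^-1.
  pose m := Num.truncn b.
  have bm : b < m.+1%:R by rewrite truncnS_gt.
  have b0 : 0 < b by rewrite !lt_max invr_gt0 divr_gt0.
  exists m; near=> w => x xm.
  have mb a : 0 < a -> a^-1 <= b -> m.+1%:R^-1 < a.
    move=> a0 ab; rewrite invf_plt ?posrE ?ltr0n//.
    exact: le_lt_trans bm.
  have : (U `*` W) (w, x).
    split => /=; first by near: w.
    apply: rW; rewrite -ball_normE /ball_/= distrC (lt_trans xm)// mb//.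
    by rewrite /b le_max lexx orbT.
  move=> /UW/= /andP[lo up]; apply/andP; split.
    by apply: lt_trans lo; rewrite mb ?divr_gt0// /b !le_max lexx.
  by apply: lt_trans up (le_lt_trans _ bm); rewrite /b !le_max lexx orbT.
set a : R := m.+1%:R in mP.
have a0 : 0 < a by rewrite ltr0n.
exists (Num.sqrt a^-1), (Num.sqrt a), a^-1.
split; rewrite ?sqrtr_gt0 ?invr_gt0//.
move=> x xa v.
have [->|v0] := eqVneq v 0.
  by rewrite normr0 !mulr0 mul0mx mul0mx mxE sqrtr0 lexx.
have vn0 : 0 < `|v| by rewrite normr_gt0.
have vE : v = `|v| *: (`|v|^-1 *: v) by rewrite scalerA mulfV ?scale1r// gt_eqF.
have := mP (`|v|^-1 *: v); rewrite /= normrZ normfV normr_id mulVf ?gt_eqF//.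
move=> /(_ erefl x xa) /andP[lo up].
rewrite [in Num.sqrt (fun_of_matrix _ _ _)]vE quadratic_formZ.
rewrite sqrtrM ?sqr_ge0// sqrtr_sqr normr_id ![_ * `|v|]mulrC !ler_pM2l//.
by rewrite !ler_wsqrtr// ltW.
Unshelve. all: by end_near. Qed.

End quadratic_forms.

Lemma is_derive_line (R : realType) (V : normedModType R) (x v : V) (s : R) :
  is_derive s 1 (fun u : R => x + u *: v) v.
Proof.
have h : h^-1 *: ((x + (h *: (1 : R^o) + s) *: v) - (x + s *: v)) @[h --> 0^'] --> v.
  apply: cvg_near_cst; near=> h.
  have -> : h *: (1 : R^o) = h by rewrite /GRing.scale/= mulr1.
  rewrite opprD addrACA subrr add0r scalerDl addrK scalerA.
  have h0 : h != 0 by near: h; exact: nbhs_dnbhs_neq.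
  by rewrite mulVf ?scale1r.
by split; [apply/cvg_ex; exists v|exact: cvg_lim].
Unshelve. all: by end_near. Qed.

Section riemannian_topology.
Context (R : realType) (n : nat) (M : topologicalType).
Context (A : smooth_manifold R n M) (g : riemannian_metric A).
Local Notation mu := (@lebesgue_measure R).

Definition speed (i : chart_index A) (c : R -> 'rV[R]_n) (s : R) : R :=
  Num.sqrt (inner g i (c s) (derive1 c s) (derive1 c s)).

Lemma gram_continuous (i : chart_index A) (x : 'rV[R]_n) :
  chart_cod i x -> {for x, continuous (gram g i)}.
Proof. by move=> /(@gram_smooth _ _ _ _ g i [::])/differentiable_continuous. Qed.

Lemma speed_within_continuous (i : chart_index A) (c : R -> 'rV[R]_n) :
  C1_arc i c -> {within `[0, 1], continuous (speed i c)}.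
Proof.
move=> [ci cd cc]; apply/subspace_continuousP => s sI.
apply: (cvg_comp _ Num.sqrt); last exact: sqrt_continuous.
have cs : c @ within `[0, 1] (nbhs s) --> c s.
  apply: cvg_within_filter; apply: differentiable_continuous.
  by apply/derivable1_diffP; exact: cd.
apply: cvg_quadratic_form.
- by apply: (cvg_comp _ (gram g i)) cs _; apply: gram_continuous; exact: ci.
- by move/subspace_continuousP: cc; exact.
- by move/subspace_continuousP: cc; exact.
Qed.

Lemma arc_lengthE (i : chart_index A) (c : R -> 'rV[R]_n) : C1_arc i c ->
  arc_length g i c = (\int[mu]_(s in `[0%R, 1%R]) speed i c s)%:E.
Proof.
move=> ic; rewrite /Rintegral fineK//.
apply: integrable_fin_num => //; apply: within_continuous_integrable.
exact: speed_within_continuous.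
Qed.

Lemma path_length_ge0 (p q : M) (l : \bar R) : path_length g p q l -> (0 <= l)%E.
Proof.
elim=> {p q l}// i c q l _ _ l0; apply: adde_ge0 => //.
by apply: integral_ge0 => s _; rewrite lee_fin sqrtr_ge0.
Qed.

Lemma path_length_cat (p q r : M) (l l' : \bar R) :
  path_length g p q l -> path_length g q r l' -> path_length g p r (l + l')%E.
Proof.
move=> pq; elim: pq r l' => {p q l}[p|i c q l ic pq IH] r l' qr.
  by rewrite add0e.
by rewrite -addeA; apply: path_length_cons => //; exact: IH.
Qed.

Lemma riemannian_dist_ge0 (p q : M) : (0 <= riemannian_dist g p q)%E.
Proof. by apply: le_ereal_inf_tmp => l; exact: path_length_ge0. Qed.

Lemma riemannian_dist_triangle (q p r : M) :
  (riemannian_dist g p r <= riemannian_dist g p q + riemannian_dist g q r)%E.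
Proof.
have := riemannian_dist_ge0 p q; have := riemannian_dist_ge0 q r.
set d1 := riemannian_dist g p q; set d2 := riemannian_dist g q r => d20 d10.
have [d1oo|d1oo] := eqVneq d1 +oo%E.
  by rewrite d1oo addye ?leey// gt_eqF// (lt_le_trans _ d20).
have [d2oo|d2oo] := eqVneq d2 +oo%E.
  by rewrite d2oo addey ?leey// gt_eqF// (lt_le_trans _ d10).
have d1f : d1 \is a fin_num by rewrite ge0_fin_numE// ltey.
have d2f : d2 \is a fin_num by rewrite ge0_fin_numE// ltey.
apply/lee_addgt0Pr => e e0.
have e20 : 0 < e / 2 by rewrite divr_gt0.
have [l1 pl1 l1d] := lb_ereal_inf_adherent e20 d1f.
have [l2 pl2 l2d] := lb_ereal_inf_adherent e20 d2f.
apply: (@le_trans _ _ (l1 + l2)%E).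
  by apply: ereal_inf_lbound; exact: path_length_cat pl1 pl2.
rewrite [e]splitr EFinD addeACA; exact/leeD/ltW/l2d/ltW.
Qed.

(** Two points of a small coordinate ball are joined by the straight segment, which stays in the
    ball by convexity and has length at most [C * |v|]. *)
Lemma riemannian_dist_small (p : M) (e : R) : 0 < e ->
  exists2 V, nbhs p V &
    forall q q', V q -> V q' -> (riemannian_dist g q q' < e%:E)%E.
Proof.
move=> e0; have [i ip] := chart_cover A p.
set x0 := chart i p.
have ix0 : chart_cod i x0 by exists p.
have [c [C [d1 [_ C0 d10 bnd]]]] := quadratic_form_local_bounds
  (gram_continuous ix0) (fun v => @gram_posdef _ _ _ _ g i x0 v ix0).
have /nbhs_ballP[d2 /= d20 d2P] : nbhs x0 (chart_cod i).
  by apply: open_nbhs_nbhs; split => //; exact: chart_cod_open.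
(* The last term gives [C * |v| < e], because [|v| < d + d]. *)
pose d := Num.min (Num.min d1 d2) (e / C / 2).
have d0 : 0 < d by rewrite !lt_min d10 d20 !divr_gt0.
exists (chart_dom i `&` chart i @^-1` [set x | `|x - x0| < d]).
  apply: filterI; first by apply: open_nbhs_nbhs; split => //; exact: chart_dom_open.
  apply: (@chart_continuous _ _ _ A i p (mem_set ip)).
  by apply/nbhs_ballP; exists d => // x; rewrite -ball_normE/= distrC.
move=> q q' [iq qd] [iq' qd'].
set x := chart i q in qd; set x' := chart i q' in qd'.
pose v := x' - x.
pose arc s := x + s *: v.
have arcd s : s \in `[0, 1] -> `|arc s - x0| < d.
  rewrite in_itv/= => /andP[s0 s1].
  have -> : arc s - x0 = (1 - s) *: (x - x0) + s *: (x' - x0).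
    by apply/matrixP => a b; rewrite /arc /v !mxE; ring.
  apply: le_lt_trans (ler_normD _ _) _.
  rewrite !normrZ !ger0_norm ?subr_ge0//.
  have [->|sn0] := eqVneq s 0; first by rewrite subr0 mul1r mul0r addr0.
  have s0' : 0 < s by rewrite lt_neqAle eq_sym sn0.
  have -> : d = (1 - s) * d + s * d by ring.
  by apply: ler_ltD; [rewrite ler_wpM2l ?subr_ge0// ltW|rewrite ltr_pM2l].
have dd1 : d <= d1 by rewrite /d !ge_min lexx.
have dd2 : d <= d2 by rewrite /d !ge_min lexx orbT.
have arc_deriv (s : R) : is_derive s 1 arc v by exact: is_derive_line.
have arc' : derive1 arc = cst v.
  by apply/funext => s; rewrite derive1E; apply: derive_val.
have C1 : C1_arc i arc.
  split.
  - move=> s /arcd sd; apply: d2P; rewrite -ball_normE/= distrC.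
    exact: lt_le_trans dd2.
  - by move=> s _; apply: ex_derive.
  - by rewrite arc' => s; exact: cvg_cst.
have q0 : chart_inv i (arc 0) = q by rewrite /arc scale0r addr0 chartK.
have q1 : chart_inv i (arc 1) = q' by rewrite /arc scale1r addrC subrK chartK.
have pl : path_length g q q' (arc_length g i arc + 0)%E.
  by rewrite -{1}q0; apply: path_length_cons => //; rewrite q1; exact: path_length_nil.
apply: le_lt_trans (ereal_inf_lbound pl) _; rewrite adde0 arc_lengthE// lte_fin.
apply: (@le_lt_trans _ _ (\int[mu]_(s in `[0%R, 1%R]) (cst (C * `|v|) s))%R).
  apply: le_Rintegral => //.
  - by apply: within_continuous_integrable; exact: speed_within_continuous.
  - by apply: within_continuous_integrable => s; exact: cvg_cst.
  - move=> s sI; rewrite /speed arc'.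
    by have /andP[] := bnd (arc s) (lt_le_trans (arcd s sI) dd1) v.
rewrite Rintegral_cst//= lebesgue_measure_itv/= lte01 oppr0 adde0/= mulr1.
have vd : `|v| < d + d.
  rewrite /v (_ : x' - x = (x' - x0) - (x - x0)); last by rewrite opprB addrA subrK.
  by apply: le_lt_trans (ler_normB _ _) _; exact: ltrD.
rewrite mulrC -ltr_pdivlMr//; apply: lt_le_trans vd _.
have : d <= e / C / 2 by rewrite /d ge_min lexx orbT.
by lra.
Qed.

(** * Paths that leave a chart *)

Lemma dist_continuous (x0 : 'rV[R]_n) : continuous (fun x : 'rV[R]_n => `|x - x0|).
Proof.
move=> x.
apply: (@continuous_comp _ _ _ (fun y : 'rV[R]_n => y - x0)); last exact: norm_continuous.
by apply: continuousB; [exact: cvg_id|exact: cst_continuous].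
Qed.

(* Cut off at [dl] so as to make sense along paths that leave the chart. *)
Definition chart_radius (i : chart_index A) (x0 : 'rV[R]_n) (dl : R) (q : M) : R :=
  if `[< chart_dom i q /\ `|chart i q - x0| < dl >] then `|chart i q - x0| else dl.

Lemma chart_radius_lt (i : chart_index A) (x0 : 'rV[R]_n) (dl : R) (q : M) :
  chart_radius i x0 dl q < dl <-> chart_dom i q /\ `|chart i q - x0| < dl.
Proof.
rewrite /chart_radius; case: asboolP => [[? ->]|H]; first by split.
by rewrite ltxx; split.
Qed.

Lemma chart_radius_in (i : chart_index A) (x0 : 'rV[R]_n) (dl : R) (q : M) :
  chart_dom i q -> `|chart i q - x0| < dl ->
  chart_radius i x0 dl q = `|chart i q - x0|.
Proof. by move=> iq qd; rewrite /chart_radius; case: asboolP => // -[]. Qed.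

(** The set is the image under [chart_inv] of a closed coordinate ball, hence compact, hence closed
    in the Hausdorff space [M]. So a limit of points of radius at most [a] cannot fall outside the
    chart ball. *)
Lemma chart_radius_sublevel_closed (i : chart_index A) (x0 : 'rV[R]_n) (dl a : R) :
  (forall x, `|x - x0| < dl -> chart_cod i x) -> a < dl ->
  closed [set q | chart_radius i x0 dl q <= a].
Proof.
move=> cod adl.
have -> : [set q | chart_radius i x0 dl q <= a] =
    chart_inv i @` [set x | `|x - x0| <= a].
  apply/seteqP; split => q /=.
    move=> qa; have /chart_radius_lt[iq qd] := le_lt_trans qa adl.
    by exists (chart i q); [rewrite -(chart_radius_in iq qd)|rewrite chartK].
  move=> [x xa <-]; have xdl := le_lt_trans xa adl.
  have [p ip xE] := cod _ xdl.
  by rewrite -xE chartK// chart_radius_in// xE.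
apply: compact_closed; first exact: manifold_hausdorff A.
apply: continuous_compact.
  apply/subspace_continuousP => x /= xa; apply: cvg_within_filter.
  apply: chart_inv_continuous; apply/mem_set; apply: cod.
  exact: le_lt_trans adl.
apply: bounded_closed_compact.
  exists (`|x0| + a); split; [exact: num_real|move=> b ab x /= xa].
  apply: ltW; apply: le_lt_trans ab.
  rewrite -[x](subrK x0) [x - _ + _]addrC; apply: le_trans (ler_normD _ _) _.
  by rewrite lerD2l.
rewrite (_ : [set _ | _] = (fun x => `|x - x0|) @^-1` [set u : R | u <= a])//.
by apply: preimage_closed => [x _|]; [exact: dist_continuous|exact: closed_le].
Qed.

(** An instance of [le_integral_of_local] for [k * r]. The arc is given in chart [j] and the radius
    in chart [i]; where the radius is below [dl] the transition map applies, and [gram_compat] turns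
    the lower bound in chart [i] into a bound by the speed in chart [j]. *)
Lemma arc_chart_radius (i j : chart_index A) (x0 : 'rV[R]_n) (dl k : R)
    (c : R -> 'rV[R]_n) :
  0 < k ->
  (forall x, `|x - x0| < dl -> chart_cod i x /\
     forall v, k * `|v| <= Num.sqrt (inner g i x v v)) ->
  C1_arc j c ->
  let r s := chart_radius i x0 dl (chart_inv j (c s)) in
  let len := (\int[mu]_(s in `[0%R, 1%R]) speed j c s)%R in
  k * r 0 + len < k * dl ->
  k * r 1 <= k * r 0 + len.
Proof.
move=> k0 ibnd jc r len rdl.
have [jcod cd cc] := jc.
have spc := speed_within_continuous jc.
have jdom s : s \in `[0, 1] -> chart_dom j (chart_inv j (c s)) /\
    chart j (chart_inv j (c s)) = c s.
  by move=> /jcod[q jq <-]; rewrite chartK.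
have gcont s : s \in `[0, 1] -> {for s, continuous (fun u => chart_inv j (c u))}.
  move=> sI; apply: continuous_comp.
    by apply: differentiable_continuous; apply/derivable1_diffP; exact: cd.
  by apply: chart_inv_continuous; apply/mem_set; exact: jcod.
apply: (@le_integral_of_local _ (speed j c) (fun s => k * r s) (k * dl)) => //.
- by move=> s _; exact: sqrtr_ge0.
- move=> s e sI; rewrite ltr_pM2l// => /chart_radius_lt[iq qd] e0.
  set q := chart_inv j (c s) in iq qd *.
  have [jq cq] := jdom s sI.
  pose E u := chart i (chart_inv j (c u)).
  have dtr : differentiable (chart i \o chart_inv j) (c s).
    by apply: (@chart_smooth _ _ _ A j i [::]); exists q.
  have dc : differentiable c s by apply/derivable1_diffP; exact: cd.
  have dE : derivable E s 1.
    apply/derivable1_diffP.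
    rewrite (_ : E = (chart i \o chart_inv j) \o c)//.
    exact: differentiable_comp.
  have E's : derive1 E s = 'd (chart i \o chart_inv j) (c s) (derive1 c s).
    rewrite derive1E'; last exact/derivable1_diffP.
    rewrite (_ : E = (chart i \o chart_inv j) \o c)// diff_comp//=.
    by rewrite derive1E'.
  have spE : k * `|derive1 E s| <= speed j c s.
    have [_ /(_ (derive1 E s))/le_trans] := ibnd _ qd; apply.
    have := gram_compat g (derive1 c s) (derive1 c s) jq iq.
    by rewrite cq /speed /inner E's => ->.
  have : \forall u \near s, chart_dom i (chart_inv j (c u)) /\
      `|chart i (chart_inv j (c u)) - x0| < dl.
    apply: (gcont s sI [set q' | chart_dom i q' /\ `|chart i q' - x0| < dl]).
    apply: filterI; first by apply: open_nbhs_nbhs; split => //; exact: chart_dom_open.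
    apply: (@chart_continuous _ _ _ A i q (mem_set iq) [set x | `|x - x0| < dl]).
    have : \forall x \near chart i q, `|x - x0| < dl.
      exact: (cvgr_lt _ (@dist_continuous x0 (chart i q))).
    exact.
  (* The error is divided by [k] because the estimate on [E] is multiplied by [k] afterwards. *)
  have ek0 : 0 < e / k by rewrite divr_gt0.
  move: (derivable_local_growth dE ek0); apply: filterS2 => u Eu [iu ud] uI.
  rewrite /r !chart_radius_in//.
  have : `|E u - x0| <= `|E u - E s| + `|E s - x0|.
    by rewrite (_ : E u - x0 = (E u - E s) + (E s - x0)) ?ler_normD// addrA subrK.
  move=> /le_trans/(_ (lerD Eu (lexx _))); rewrite -(ler_pM2l k0) => /le_trans; apply.
  rewrite mulrDr addrC lerD2l mulrA ler_wpM2r// mulrDr [k * (e / k)]mulrC divfK ?gt_eqF//.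
  by rewrite lerD2r.
- move=> a adl t clt.
  have tI : t \in `[0, 1].
    have cI : closed `[0 : R, 1]%classic by exact: interval_closed.
    by apply: cI; apply: closure_subset clt => s [].
  split => //; rewrite mulrC -ler_pdivlMr//.
  have adl' : a / k < dl by rewrite ltr_pdivrMr// mulrC.
  apply: (chart_radius_sublevel_closed (fun x xd => (ibnd x xd).1) adl').
  move=> B /(gcont t tI)/clt[s [[sI rs] Bs]]; exists (chart_inv j (c s)); split => //.
  by rewrite /= ler_pdivlMr// mulrC.
Qed.

(** Leaving the coordinate ball of radius [dl] costs a length of at least [k * dl], where [k] bounds
    the metric from below by the coordinate norm. *)
Lemma riemannian_dist_ball (p : M) (V : set M) : nbhs p V ->
  exists2 e : R, 0 < e & forall q, (riemannian_dist g p q < e%:E)%E -> V q.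
Proof.
move=> pV; have [i ip] := chart_cover A p.
set x0 := chart i p.
have ix0 : chart_cod i x0 by exists p.
have [k [C [d1 [k0 _ d10 bnd]]]] := quadratic_form_local_bounds
  (gram_continuous ix0) (fun v => @gram_posdef _ _ _ _ g i x0 v ix0).
have /nbhs_ballP[d2 /= d20 d2P] : nbhs x0 (chart_cod i).
  by apply: open_nbhs_nbhs; split => //; exact: chart_cod_open.
have : \forall x \near x0, V (chart_inv i x).
  by apply: (@chart_inv_continuous _ _ _ A i x0 (mem_set ix0)); rewrite chartK.
move=> /nbhs_ballP[d3 /= d30 d3P].
pose dl := Num.min (Num.min d1 d2) d3.
have dl0 : 0 < dl by rewrite !lt_min d10 d20 d30.
have dld x : `|x - x0| < dl -> [/\ `|x - x0| < d1, chart_cod i x & V (chart_inv i x)].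
  rewrite !lt_min => /andP[/andP[xd1 xd2] xd3]; split => //.
    by apply: d2P; rewrite -ball_normE/= distrC.
  by apply: d3P; rewrite -ball_normE/= distrC.
(* The starting point varies in the induction over arcs, so [k] times its radius is counted together
   with the remaining length. *)
have path_radius q q' l : path_length g q q' l ->
    ((k * chart_radius i x0 dl q)%:E + l < (k * dl)%:E)%E ->
    chart_radius i x0 dl q' < dl.
  elim=> {q q' l}[q|j c q l jc pl IH]; first by rewrite adde0 lte_fin ltr_pM2l.
  have l0 := path_length_ge0 pl.
  rewrite arc_lengthE// addeA -EFinD => H; apply: IH.
  apply: le_lt_trans (H); apply: leeD => //; rewrite lee_fin.
  apply: (arc_chart_radius k0) => //.
    by move=> x /dld[xd1 xi _]; split => // v; have /andP[] := bnd x xd1 v.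
  by rewrite -lte_fin; apply: le_lt_trans H; exact: leeDl.
have rp : chart_radius i x0 dl p = 0.
  by rewrite chart_radius_in// subrr normr0.
exists (k * dl); first by rewrite mulr_gt0.
move=> q /ereal_inf_lt[l pl lk].
have /chart_radius_lt[iq /dld[_ _]] : chart_radius i x0 dl q < dl.
  by apply: path_radius pl _; rewrite rp mulr0 add0e.
by rewrite chartK.
Qed.

End riemannian_topology.

(** * Cocompact groups of deck transformations *)

Section fuchsian_group.
Context (R : realType) (Gamma : aut_subgroup R).
Implicit Types (f g : disk R -> disk R).

Lemma Gamma1 : agset Gamma idfun.
Proof. by case: (agset_group Gamma). Qed.

Lemma GammaM f g : agset Gamma f -> agset Gamma g -> agset Gamma (f \o g).
Proof. by case: (agset_group Gamma) => _ + _; apply. Qed.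

Lemma GammaV f : agset Gamma f ->
  exists2 g, agset Gamma g & cancel f g /\ cancel g f.
Proof. by case: (agset_group Gamma) => _ _; apply. Qed.

Lemma dP_Gamma f x y : agset Gamma f -> dP (f x) (f y) = dP x y.
Proof. by move=> /(@agset_aut _ Gamma)/dP_aut. Qed.

Lemma Gamma_continuous f : agset Gamma f -> continuous f.
Proof. by move=> /(@agset_aut _ Gamma)/disk_aut_continuous. Qed.

Lemma orbit_rel_piP x y :
  \pi_(surface Gamma) x = \pi_(surface Gamma) y ->
  exists2 f, agset Gamma f & f x = y.
Proof.
by move=> /eqmodP => /asboolP.
Qed.

(** The images of the balls [dP0 < n] increase to the whole surface; they are open because the
    preimage of each is a union of translates of the ball. *)
Lemma Gamma_cobounded : compact [set: surface Gamma] ->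
  exists D : R, forall x, exists2 f, agset Gamma f & dP0 (f x) < D.
Proof.
move=> cS.
pose P (n : nat) (s : surface Gamma) :=
  exists x, \pi_(surface Gamma) x = s /\ dP0 x < n%:R.
have [||n nP] := compact_uniform_index (P := P) cS.
- move=> m n s mn [x [xs xm]]; exists x; split => //.
  by apply: lt_le_trans xm _; rewrite ler_nat.
- move=> s _; pose x := repr s; pose n := (Num.truncn (dP0 x)).+1.
  exists n; exists [set s' | P n s']; split => //=; last first.
    by exists x; rewrite reprK; split => //; exact: truncnS_gt.
  rewrite /open/= /quotient_open.
  rewrite (_ : _ @^-1` _ = \bigcup_(f in agset Gamma) (f @^-1` [set y | dP0 y < n%:R])).
    apply: bigcup_open => f Gf; apply: open_comp.
      by move=> y _; exact: Gamma_continuous.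
    under eq_set do rewrite -dP0_dP.
    exact: dP_ball_open.
  apply/seteqP; split => y /=.
    move=> [z [zy zn]]; have [f Gf fy] := orbit_rel_piP (esym zy).
    by exists f => //=; rewrite fy.
  move=> [f Gf /= fy]; exists (f y); split => //.
  by apply/esym/eqmodP/asboolP; exists f.
exists n%:R => x; have [y [yx yn]] := nP (\pi_(surface Gamma) x) I.
have [f Gf fx] := orbit_rel_piP (esym yx).
by exists f => //; rewrite fx.
Qed.

(** On a compact set meeting every orbit, the bound comes from the neighbourhoods disjoint from
    their translates; conjugation by an element bringing [x] into that set preserves the
    displacement. *)
Lemma Gamma_injectivity_radius :
  deck_action Gamma -> compact [set: surface Gamma] ->
  exists2 e : R, 0 < e & forall f x, agset Gamma f -> dP x (f x) < e -> f = idfun.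
Proof.
move=> [_ hdeck] /Gamma_cobounded[D DP].
have [K cK KP] := dP0_ball_precompact D.
pose P (n : nat) x := forall f, agset Gamma f ->
  dP x (f x) < n.+1%:R^-1 -> f = idfun.
have [||n nP] := compact_uniform_index (P := P) cK.
- move=> m n x mn Px f Gf fx; apply: Px => //; apply: lt_le_trans fx _.
  by rewrite lef_pV2 ?posrE ?ltr0n// ler_nat ltnS.
- move=> x _; have [U /disk_nbhsP[r r0 rU] Udisj] := hdeck x.
  have r20 : 0 < r / 2 by rewrite divr_gt0.
  pose m := Num.truncn (r / 2)^-1; exists m.
  have mr : m.+1%:R^-1 <= r / 2.
    by rewrite invf_ple ?posrE ?ltr0n// ltW// truncnS_gt.
  apply/disk_nbhsP; exists (r / 2) => // y xy f Gf fy.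
  apply: contrapT => fid; have := Udisj f Gf fid.
  rewrite -subset0 => /(_ (f y)); apply; split; last first.
    by exists y => //; apply: rU; lra.
  apply: rU; apply: le_lt_trans (dP_triangle y _ _) _.
  by have := lt_le_trans fy mr; lra.
exists n.+1%:R^-1; first by rewrite invr_gt0 ltr0n.
move=> f x Gf fx; have [h Gh hx] := DP x.
have [h' Gh' [hK h'K]] := GammaV Gh.
have : h \o f \o h' = idfun.
  apply: (nP (h x) (KP _ (ltW hx))).
    by apply: GammaM => //; exact: GammaM.
  by rewrite /= hK dP_Gamma.
move=> E; apply/funext => y.
by have := congr1 (fun u => h' (u (h y))) E; rewrite /= !hK.
Qed.

Section words.
Context (T : Type) (G : set (T -> T)) (om : (T -> T) -> R).

Definition weighted_word (l : R) (f : T -> T) : Prop :=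
  exists (k : nat) (g : 'I_k -> T -> T),
    [/\ forall i, G (g i), \sum_(i < k) om (g i) <= l & f = word g].

Lemma weighted_word_cons (l : R) (f a : T -> T) :
  G a -> weighted_word l f -> weighted_word (om a + l) (a \o f).
Proof.
move=> Ga [k [g [Gg gl ->]]].
pose g' (i : 'I_k.+1) := if unlift ord0 i is Some j then g j else a.
have g'0 : g' ord0 = a by rewrite /g' unlift_none.
have g'S j : g' (lift ord0 j) = g j by rewrite /g' liftK.
exists k.+1, g'; split.
- by move=> i; rewrite /g'; case: unlift.
- rewrite big_ord_recl g'0 lerD2l; apply: le_trans gl.
  by apply: ler_sum => i _; rewrite g'S.
- rewrite /word big_ord_recl g'0; congr (_ \o _).
  by apply: eq_bigr => i _; rewrite g'S.
Qed.

Lemma weighted_word_comp (l l' : R) (f f' : T -> T) :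
  weighted_word l f -> weighted_word l' f' -> weighted_word (l + l') (f \o f').
Proof.
move=> [k [g [Gg gl ->]]] Wf'.
have : weighted_word (\sum_(i < k) om (g i) + l') (word g \o f').
  elim: k g Gg {gl} => [|k IH] g Gg; first by rewrite /word !big_ord0 add0r.
  rewrite /word !big_ord_recl -addrA; apply: weighted_word_cons => //.
  exact: IH.
move=> [k' [g' [Gg' gl' ->]]]; exists k', g'; split => //.
by apply: le_trans gl' _; rewrite lerD2r.
Qed.

Lemma weighted_word_le (l l' : R) (f : T -> T) : l <= l' -> weighted_word l f -> weighted_word l' f.
Proof. by move=> ll [k [g [Gg gl ->]]]; exists k, g; split => //; exact: le_trans ll. Qed.

End words.

Lemma word_Gamma (G : set (disk R -> disk R)) k (g : 'I_k -> disk R -> disk R) :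
  G `<=` agset Gamma -> (forall i, G (g i)) -> agset Gamma (word g).
Proof.
move=> GG; elim: k g => [|k IH] g Gg; first by rewrite /word big_ord0; exact: Gamma1.
by rewrite /word big_ord_recl; apply: GammaM; [exact: GG|exact: IH].
Qed.

(** The displacement of the origin is subadditive, [Gamma] acting by isometries. This is what puts
    [w^-1(0)] in the closed disk of radius [r] when the word [w] has weight at most [r]. *)
Lemma dP0_word (G : set (disk R -> disk R)) k (g : 'I_k -> disk R -> disk R) :
  G `<=` agset Gamma -> (forall i, G (g i)) ->
  dP0 (word g (disk0 R)) <= \sum_(i < k) omega (g i).
Proof.
move=> GG; elim: k g => [|k IH] g Gg.
  by rewrite /word !big_ord0 /= -dP0_dP dPxx.
rewrite /word !big_ord_recl /= -dP0_dP.
apply: le_trans (dP_triangle (g ord0 (disk0 R)) _ _) _.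
rewrite dP0_dP lerD2l dP_Gamma; last exact: GG.
by rewrite dP0_dP; apply: IH.
Qed.

(* The Svarc-Milnor argument, where the compactness of a ball replaces the
   finiteness of the set of elements of [Gamma] with bounded displacement. *)
Lemma short_word_to_core (G : set (disk R -> disk R)) :
  compact [set: surface Gamma] -> symmetric_generators Gamma G ->
  exists D W : R, 0 < W /\ forall r x, 0 <= r -> dP0 x <= r ->
    exists2 f, weighted_word G (@omega R) (W * (r + 1)) f & dP0 (f x) <= D.
Proof.
move=> cS [_ GG _ Ggen].
have [D DP] := Gamma_cobounded cS.
(* After a unit step along the ray the image point is at distance at most [D + 1] from the origin;
   one more word of weight at most [W] brings it back. *)
have [K cK KP] := dP0_ball_precompact (D + 1).
(* The strict inequality is an open condition, so one word serves all points near [x]. *)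
pose P (n : nat) x := exists2 f, weighted_word G (@omega R) n%:R f & dP0 (f x) < D.
have [||W WP] := compact_uniform_index (P := P) cK.
- move=> m n x mn [f Wf fx]; exists f => //; apply: weighted_word_le Wf.
  by rewrite ler_nat.
- move=> x _; have [f Gf fx] := DP x; have [k [g [Gg fg]]] := Ggen f Gf.
  pose l := \sum_(i < k) omega (g i).
  exists (Num.truncn l).+1.
  have : \forall y \near x, dP0 (f y) < D.
    apply/disk_nbhsP; exists (D - dP0 (f x)); first by rewrite subr_gt0.
    move=> y; rewrite ltrBrDl; apply: le_lt_trans.
    by rewrite -!dP0_dP -(dP_Gamma x y Gf); exact: dP_triangle.
  apply: filterS => y fy; exists f => //; exists k, g; split => //.
  by apply/ltW; exact: truncnS_gt.
have GW l f : weighted_word G (@omega R) l f -> agset Gamma f.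
  by move=> [k [g [Gg _ ->]]]; exact: word_Gamma Gg.
have step (n : nat) : forall x, dP0 x <= n%:R ->
    exists2 f, weighted_word G (@omega R) (n.+1%:R * W%:R) f & dP0 (f x) <= D.
  elim: n => [|n IH] x xn.
    have [|f Wf fx] := WP x.
      apply: KP; apply: le_trans xn _.
      have [f _ /(le_lt_trans (dP0_ge0 _))] := DP x; lra.
    by exists f; [rewrite mul1r|exact: ltW].
  have [y [yn yx]] := radial_step x (ler01 : 0 <= 1 :> R).
  have yn' : dP0 y <= n%:R.
    apply: le_trans yn _; rewrite ge_max ler0n/= lerBlDr.
    by rewrite -natr1 in xn.
  have [f Wf fy] := IH y yn'.
  have fx : dP0 (f x) <= D + 1.
    rewrite -dP0_dP; apply: le_trans (dP_triangle (f y) _ _) _.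
    rewrite dP0_dP dP_Gamma; last exact: GW Wf.
    by lra.
  have [h Wh hx] := WP (f x) (KP _ fx).
  exists (h \o f); last exact: ltW.
  apply: weighted_word_le (weighted_word_comp Wh Wf).
  by rewrite -[n.+2%:R]natr1 mulrDl mul1r addrC.
(* The induction gives weight [(n + 1) * W] with [n <= r + 1], and [(r + 2) * W <= 2 * W * (r + 1)];
   the extra 1 makes the constant positive. *)
exists D, (W%:R + W%:R + 1); split; first by have : 0 <= W%:R :> R by []; lra.
move=> r x r0 xr; pose n := (Num.truncn r).+1.
have rn : r <= n%:R by apply/ltW; exact: truncnS_gt.
have nr : n%:R <= r + 1.
  by rewrite /n -natr1 lerD2r; have /andP[] := truncn_itv r0.
have [f Wf fx] := step n x (le_trans xr rn).
exists f => //; apply: weighted_word_le Wf.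
rewrite -[n.+1%:R]natr1.
have W0 : 0 <= W%:R :> R by [].
have : (n%:R + 1) * W%:R <= (r + 2) * W%:R by apply: ler_wpM2r => //; lra.
have : 0 <= r * W%:R by rewrite mulr_ge0.
by nra.
Qed.

End fuchsian_group.

(** * Suspensions *)

Section suspension_topology.
Context (R : realType) (Gamma : aut_subgroup R) (T : topologicalType).
Context (rho : representation Gamma T).
Implicit Types (z w : disk R) (t s : T) (f : disk R -> disk R).

Lemma susp_pt_surj (x : suspension rho) : exists z t, susp_pt rho z t = x.
Proof.
exists (repr x).1, (repr x).2; rewrite /susp_pt -surjective_pairing; exact: reprK.
Qed.

Lemma susp_pt_act f z t : agset Gamma f ->
  susp_pt rho (f z) (rho f t) = susp_pt rho z t.
Proof.
by move=> Gf; apply/esym/eqmodP/asboolP; exists f.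
Qed.

Lemma susp_pt_eq z t w s : susp_pt rho z t = susp_pt rho w s ->
  exists2 f, agset Gamma f & f z = w /\ rho f t = s.
Proof. by move=> /eqmodP/asboolP[f Gf /= [<- <-]]; exists f. Qed.

Lemma susp_pt_continuous : continuous (fun p => susp_pt rho p.1 p.2).
Proof.
rewrite (_ : (fun p => _) = \pi_(suspension rho)); first exact: pi_continuous.
by apply/funext => -[].
Qed.

Lemma susp_pt_open (B : set (disk R * T)) : open B ->
  open [set susp_pt rho p.1 p.2 | p in B].
Proof.
move=> oB; rewrite /open/= /quotient_open.
rewrite (_ : _ @^-1` _ =
    \bigcup_(f in agset Gamma) ((fun p : disk R * T => (f p.1, rho f p.2)) @^-1` B)).
  apply: bigcup_open => f Gf; apply: open_comp => // -[z t] _.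
  have c1 : (fun p : disk R * T => f p.1) @ (z, t) --> f z.
    by apply: continuous_comp; [exact: cvg_fst|exact: (Gamma_continuous Gf)].
  have c2 : (fun p : disk R * T => rho f p.2) @ (z, t) --> rho f t.
    apply: continuous_comp; first exact: cvg_snd.
    by have [+ _] := rep_homeo rho Gf; apply.
  exact: cvg_pair c1 c2.
apply/seteqP; split => -[z t] /=.
  move=> [[w s] Bws /esym/susp_pt_eq[f Gf [/= fz ft]]].
  by exists f => //=; rewrite fz ft.
by move=> [f Gf /= Bf]; exists (f z, rho f t) => //=; exact: susp_pt_act.
Qed.

Lemma suspension_compact : compact [set: surface Gamma] -> compact [set: T] ->
  compact [set: suspension rho].
Proof.
move=> /Gamma_cobounded[D DP] cT.
have [K cK KP] := dP0_ball_precompact D.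
rewrite (_ : [set: _] = [set susp_pt rho p.1 p.2 | p in K `*` [set: T]]).
  apply: continuous_compact; last exact: compact_setX.
  by apply: continuous_subspaceT; exact: susp_pt_continuous.
apply/seteqP; split => // x _; have [z [t <-]] := susp_pt_surj x.
have [f Gf fz] := DP z; exists (f z, rho f t); last exact: susp_pt_act.
by split => //; apply/KP/ltW.
Qed.

(** The covering may start at another representative [(tau 0, s)] of the point; an element [f] of
    [Gamma] brings it to [(0, t)], and [f \o tau], fixing the origin, is a rotation. *)
Lemma leaf_covering_at0 (phi : disk R -> suspension rho) t :
  leaf_covering phi (susp_pt rho (disk0 R) t) ->
  exists a : R, forall z, phi z = susp_pt rho (rotation a z) t.
Proof.
move=> [phi0 [s [tau [tau_aut phiE]]]].
have [f Gf [ftau fs]] : exists2 f, agset Gamma f &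
    f (tau (disk0 R)) = disk0 R /\ rho f s = t.
  by apply: susp_pt_eq; rewrite -phi0 phiE.
have [a fa] := disk_aut_comp_fix0 (agset_aut Gf) tau_aut ftau.
exists a => z; rewrite phiE /= -fa -fs; apply/esym; exact: susp_pt_act.
Qed.

End suspension_topology.

(** * Entropies *)

Section entropy_comparison.
Context (R : realType).

Lemma covering_number_le (S1 S2 : Type) (d1 : S1 -> S1 -> \bar R)
    (d2 : S2 -> S2 -> \bar R) (Y1 : set S1) (Y2 : set S2) (e1 e2 : R) :
  (forall k (c : 'I_k -> S2),
     Y2 `<=` \bigcup_i [set y | (d2 (c i) y < e2%:E)%E] ->
     exists c' : 'I_k -> S1, Y1 `<=` \bigcup_i [set y | (d1 (c' i) y < e1%:E)%E]) ->
  (covering_number d1 Y1 e1 <= covering_number d2 Y2 e2)%E.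
Proof.
move=> H; apply: le_ereal_inf_tmp => _ [k [c cY] <-].
by apply: ereal_inf_lbound; exists k => //; exact: H cY.
Qed.

Lemma covering_number_ge0 (S : Type) (d : S -> S -> \bar R) (Y : set S) (e : R) :
  (0 <= covering_number d Y e)%E.
Proof. by apply: le_ereal_inf_tmp => _ [k _ <-]; rewrite lee_fin. Qed.

Lemma covering_number_ge1 (S : Type) (d : S -> S -> \bar R) (Y : set S) (e : R) :
  Y !=set0 -> (1 <= covering_number d Y e)%E.
Proof.
move=> [y Yy]; apply: le_ereal_inf_tmp => _ [[|k] [c cY] <-].
  by have [[]] := cY y Yy.
by rewrite lee_fin ler1n.
Qed.

Lemma covering_number0 (S : Type) (d : S -> S -> \bar R) (e : R) :
  covering_number d set0 e = 0%E.
Proof.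
apply/eqP; rewrite eq_le covering_number_ge0 andbT.
apply: ereal_inf_lbound; exists 0%N => //.
have c : 'I_0 -> S by case.
by exists c => y.
Qed.

Lemma lee_covering_lne (x y : \bar R) : (0 <= x -> x <= y -> lne x <= lne y)%E.
Proof.
move=> x0 xy; have y0 := le_trans x0 xy.
by rewrite lee_lne// in_itv/= ?x0 ?y0 leey.
Qed.

Lemma limf_esup_le (F : set_system R) {FF : Filter F} (f h : R -> \bar R) :
  (\forall r \near F, (f r <= h r)%E) -> (limf_esup f F <= limf_esup h F)%E.
Proof.
move=> fh; apply: le_ereal_inf_tmp => _ [V FV <-].
apply: (@le_trans _ _ (ereal_sup (f @` (V `&` [set r | (f r <= h r)%E])))).
  by apply: ereal_inf_lbound; exists (V `&` [set r | (f r <= h r)%E]) => //; exact: filterI.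
apply: ge_ereal_sup => _ [r [Vr fhr] <-]; apply: le_trans fhr _.
by apply: ereal_sup_ubound; exists r.
Qed.

Lemma entropy_le (S1 S2 : Type) (d1 : R -> S1 -> S1 -> \bar R)
    (d2 : R -> S2 -> S2 -> \bar R) (Y1 : set S1) (Y2 : set S2) :
  (forall e, 0 < e -> exists2 e', 0 < e' & forall r, 0 < r ->
     (covering_number (d1 r) Y1 e <= covering_number (d2 r) Y2 e')%E) ->
  (entropy d1 Y1 <= entropy d2 Y2)%E.
Proof.
move=> H; apply: ge_ereal_sup => _ [e e0 <-].
have [e' e'0 He] := H e e0.
apply: (@le_trans _ _ (limf_esup (fun r : R =>
    ((r^-1)%:E * lne (covering_number (d2 r) Y2 e'))%E) (pinfty_nbhs R))); last first.
  by apply: ereal_sup_ubound; exists e'.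
apply: limf_esup_le; near=> r.
have r0 : 0 < r by near: r; exact: nbhs_pinfty_gt.
rewrite lee_pmul2l ?fin_numE// ?lte_fin ?invr_gt0//.
by apply: lee_covering_lne; [exact: covering_number_ge0|exact: He].
Unshelve. all: by end_near. Qed.

Lemma entropy_le_scale (S1 S2 : Type) (d1 : R -> S1 -> S1 -> \bar R)
    (d2 : R -> S2 -> S2 -> \bar R) (Y1 : set S1) (Y2 : set S2) (W : R) :
  0 < W -> Y1 !=set0 ->
  (forall e, 0 < e -> exists2 e', 0 < e' & forall r, 0 < r ->
     (covering_number (d2 r) Y2 e <= covering_number (d1 (W * (r + 1))%R) Y1 e')%E) ->
  (entropy d2 Y2 <= (2 * W)%R%:E * entropy d1 Y1)%E.
Proof.
move=> W0 Y10 H; apply: ge_ereal_sup => _ [e e0 <-].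
have [e' e'0 He] := H e e0.
have K0 : 0 < 2 * W by rewrite mulr_gt0.
set h := limf_esup (fun r : R =>
    ((r^-1)%:E * lne (covering_number (d1 r) Y1 e'))%E) (pinfty_nbhs R).
apply: (@le_trans _ _ ((2 * W)%R%:E * h)%E); last first.
  by rewrite lee_pmul2l ?lte_fin//; apply: ereal_sup_ubound; exists e'.
rewrite -lee_pdivrMl//; apply: le_ereal_inf_tmp => _ [V FV <-].
rewrite lee_pdivrMl//.
have [M [Mreal MV]] := FV.
(* Beyond 1, [r + 1 <= 2 * r], the source of the factor 2; beyond [M / W], the scale [W * (r + 1)]
   exceeds [M]. *)
apply: (@le_trans _ _ (ereal_sup [set ((r^-1)%:E * lne (covering_number (d2 r) Y2 e))%E
    | r in [set r | Num.max 1 (M / W) < r]])).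
  apply: ereal_inf_lbound; exists [set r | Num.max 1 (M / W) < r] => //.
  by exists (Num.max 1 (M / W)); split => //; exact: num_real.
apply: ge_ereal_sup => _ [r /= + <-]; rewrite gt_max => /andP[r1 rM].
have r0 : 0 < r by apply: lt_trans r1.
have Wr0 : 0 < W * (r + 1) by rewrite mulr_gt0// addr_gt0.
have MW : M < W * (r + 1).
  by move: rM; rewrite ltr_pdivrMr// => /lt_trans; apply; nra.
apply: (@le_trans _ _ ((2 * W)%R%:E *
    (((W * (r + 1))%R^-1)%:E * lne (covering_number (d1 (W * (r + 1))%R) Y1 e')))%E); last first.
  rewrite lee_pmul2l ?lte_fin//; apply: ereal_sup_ubound.
  by exists (W * (r + 1)) => //; exact: MV.
(* Nonnegativity of the logarithm, from [Y1] being nonempty, allows its coefficient to be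
   enlarged. *)
have ln0 : (0 <= lne (covering_number (d1 (W * (r + 1))%R) Y1 e'))%E.
  rewrite -lne1; apply: lee_covering_lne; first by rewrite lee_fin.
  exact: covering_number_ge1.
apply: (@le_trans _ _ ((r^-1)%:E * lne (covering_number (d1 (W * (r + 1))%R) Y1 e'))%E).
  rewrite lee_pmul2l ?lte_fin ?invr_gt0//.
  by apply: lee_covering_lne; [exact: covering_number_ge0|exact: He].
rewrite muleA -EFinM; apply: lee_wpmul2r => //; rewrite lee_fin.
rewrite ler_pdivlMr// ler_pdivrMl//; nra.
Qed.

Lemma entropy_set0 (S : Type) (d : R -> S -> S -> \bar R) :
  entropy d set0 = -oo%E.
Proof.
apply/eqP; rewrite -leeNy_eq; apply: ge_ereal_sup => _ [e e0 <-].
apply: (@le_trans _ _ (limf_esup (fun _ : R => -oo%E) (pinfty_nbhs R))).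
  apply: limf_esup_le; near=> r.
  have r0 : 0 < r by near: r; exact: nbhs_pinfty_gt.
  by rewrite covering_number0 le0_lneNy// gt0_muleNy// lte_fin invr_gt0.
apply: (@le_trans _ _ (ereal_sup ((fun _ : R => -oo%E : \bar R) @` setT))).
  by apply: ereal_inf_lbound; exists setT => //; exact: filterT.
by apply: ge_ereal_sup => _ [_ _ <-].
Unshelve. all: by end_near. Qed.

End entropy_comparison.

(** * Bowen metrics against weighted metrics *)

Section separation.
Context (R : realType) (Gamma : aut_subgroup R) (T : metricType R).
Context (rho : representation Gamma T).
Context (hdeck : deck_action Gamma) (hcompact : compact [set: surface Gamma]).
Context (hT : compact [set: T]).
Context (d : suspension rho -> suspension rho -> \bar R).
Hypothesis d_triangle : forall x y z, (d x z <= d x y + d y z)%E.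
Hypothesis d_small : forall (x : suspension rho) (e : R), 0 < e ->
  exists2 V, nbhs x V & forall y y', V y -> V y' -> (d y y' < e%:E)%E.
Hypothesis d_ball : forall (x : suspension rho) V, nbhs x V ->
  exists2 e : R, 0 < e & forall y, (d x y < e%:E)%E -> V y.
Context (phi : suspension rho -> disk R -> suspension rho).
Hypothesis hphi : forall x, leaf_covering (phi x) x.
Local Notation pt := (susp_pt rho).
Local Notation o := (disk0 R).

Lemma mdist_nbhs (t : T) (e : R) : 0 < e -> nbhs t [set s | mdist t s < e].
Proof. by move=> e0; rewrite -ballEmdist; exact: nbhsx_ballx. Qed.

Lemma mdist_open (t : T) (e : R) : open [set s | mdist t s < e].
Proof.
rewrite openE => s /= ts; have e0 : 0 < e - mdist t s by rewrite subr_gt0.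
apply: filterS (mdist_nbhs s e0) => u /=; rewrite ltrBrDl.
exact: le_lt_trans (metric_triangle _ _ _).
Qed.

Lemma d_near x (e : R) : 0 < e -> \forall y \near x, (d x y < e%:E)%E.
Proof.
move=> /(d_small x)[V xV Vd]; apply: filterS (xV) => y Vy.
by apply: Vd => //; exact: nbhs_singleton.
Qed.

(* The representative [(z0, t0)] of a point is chosen close to [{0} x T] when
   the point has such a representative; by injectivity of the translates near
   [0], this makes [t0] comparable with the points of the transversal. *)
Lemma separation (eta dl : R) : 0 < eta -> 0 < dl ->
  exists2 e : R, 0 < e & forall x, exists z0 t0,
    (forall f, agset Gamma f -> dP0 (f z0) < 2 * eta -> dP0 z0 < 2 * eta) /\
    forall y, (d x y < e%:E)%E ->
      exists z t, [/\ pt z t = y, dP z0 z < eta & mdist t0 t < dl].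
Proof.
move=> eta0 dl0.
have rep x : exists p : disk R * T, pt p.1 p.2 = x /\
    forall f, agset Gamma f -> dP0 (f p.1) < 2 * eta -> dP0 p.1 < 2 * eta.
  have [z [t ztx]] := susp_pt_surj x.
  have [[f [Gf fz]]|nf] := pselect (exists f, agset Gamma f /\ dP0 (f z) < 2 * eta).
    by exists (f z, rho f t); split => //=; rewrite susp_pt_act.
  by exists (z, t); split => // f Gf fz; exfalso; apply: nf; exists f.
have [r rP] := choice rep.
(* Product boxes around the chosen representatives; openness of the projection makes them
   neighbourhoods in the suspension. *)
pose V x := [set pt p.1 p.2 | p in
  [set z | dP (r x).1 z < eta] `*` [set t | mdist (r x).2 t < dl]].
have Vnbhs x : nbhs x (V x).
  apply: open_nbhs_nbhs; split.
    by apply: susp_pt_open; apply: open_setX; [exact: dP_ball_open|exact: mdist_open].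
  by exists (r x); [split; rewrite /= ?dPxx ?mdistxx|case: (rP x)].
have [e e0 eP] := lebesgue_number (V := V) (suspension_compact (rho := rho) hcompact hT)
  d_triangle d_near (fun x _ => d_ball (Vnbhs x)).
exists e => // x; have [x0 [_ _ Vx0]] := eP x I.
exists (r x0).1, (r x0).2; split; first by case: (rP x0).
by move=> y /Vx0[[z t] /= [zr tr] <-]; exists z, t.
Qed.

Lemma hyperbolic_dist_lt r c t (e : R) :
  (hyperbolic_dist d phi r c (pt o t) < e%:E)%E ->
  exists a : R, forall xi, dP0 xi <= r ->
    (d (phi c xi) (pt (rotation a xi) t) < e%:E)%E.
Proof.
have [a aP] := leaf_covering_at0 (hphi (pt o t)).
move=> /ereal_inf_lt[_ [b _ <-] sup_lt]; exists (a + b) => xi xir.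
rewrite -rotationD -aP; apply: le_lt_trans sup_lt.
by apply: ereal_sup_ubound; exists xi.
Qed.

Lemma hyperbolic_dist_le r t s (e : R) :
  (forall xi, dP0 xi <= r -> (d (pt xi t) (pt xi s) <= e%:E)%E) ->
  (hyperbolic_dist d phi r (pt o t) (pt o s) <= e%:E)%E.
Proof.
move=> H.
have [a aP] := leaf_covering_at0 (hphi (pt o t)).
have [b bP] := leaf_covering_at0 (hphi (pt o s)).
(* With the angle [a - b], both coverings turn [xi] by the same angle [a]. *)
apply: (@le_trans _ _ (ereal_sup [set d (phi (pt o t) xi) (phi (pt o s) (rotation (a - b) xi))
               | xi in [set xi : disk R | dP0 xi <= r]])).
  by apply: ereal_inf_lbound; exists (a - b).
apply: ge_ereal_sup => _ [xi /= xir <-].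
rewrite aP bP rotationD addrC subrK; apply: H.
by rewrite dP_rotation0.
Qed.

(* Along a ray from the origin, in steps of length [eta], the displacement grows
   from less than [2 * eta] to less than [4 * eta], which forces the element of
   [Gamma] to be trivial. *)
Lemma rotation_small (eta a r : R) : 0 < eta ->
  (forall f x, agset Gamma f -> dP x (f x) < 6 * eta -> f = idfun) ->
  (forall xi, dP0 xi <= r -> exists2 f, agset Gamma f &
     dP xi (f (rotation a xi)) < 2 * eta) ->
  forall xi, dP0 xi <= r -> dP xi (rotation a xi) < 2 * eta.
Proof.
move=> eta0 inj near_mod.
have step (n : nat) : forall xi, dP0 xi <= n%:R * eta -> dP0 xi <= r ->
    dP xi (rotation a xi) < 2 * eta.
  elim: n => [|n IH] xi xin xir.
    apply: le_lt_trans (dP_le_dP0 _ _) _; rewrite dP_rotation0.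
    by rewrite mul0r in xin; lra.
  have [y [yn yx]] := radial_step xi (ltW eta0).
  have xi0 := dP0_ge0 xi.
  have yn' : dP0 y <= n%:R * eta.
    apply: le_trans yn _; rewrite ge_max mulr_ge0 ?(ltW eta0)//= lerBlDr.
    by rewrite -natr1 mulrDl mul1r in xin.
  have yr : dP0 y <= r.
    by apply: le_trans yn _; rewrite ge_max (le_trans xi0 xir)/= lerBlDr; lra.
  have h1 := IH y yn' yr.
  have h2 : dP xi (rotation a xi) < 4 * eta.
    apply: le_lt_trans (dP_triangle y _ _) _.
    have := dP_triangle (rotation a y) y (rotation a xi).
    by rewrite dP_rotation (dPC xi y); lra.
  have [f Gf fxi] := near_mod xi xir.
  (* A displacement below [4 * eta] inherited from [y], and below [2 * eta] modulo [Gamma]: [f]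
     moves the rotated point by less than [6 * eta]. *)
  have fid : f = idfun.
    apply: (inj f (rotation a xi) Gf).
    apply: le_lt_trans (dP_triangle xi _ _) _.
    by rewrite (dPC _ xi); lra.
  by rewrite fid in fxi.
move=> xi xir; apply: (step (Num.truncn (dP0 xi / eta)).+1) => //.
by rewrite -ler_pdivrMr// ltW// truncnS_gt.
Qed.

(** The centre [c] is an arbitrary point of the suspension. The points [t] and [s] are compared
    through [phi c], one [xi] at a time, rather than by a triangle inequality for the Bowen
    distance. *)
Lemma weighted_dist_lt_of_hyperbolic (G : set (disk R -> disk R)) (dl : R) :
  G `<=` agset Gamma -> 0 < dl ->
  exists2 e : R, 0 < e & forall r c t s,
    (hyperbolic_dist d phi r c (pt o t) < e%:E)%E ->
    (hyperbolic_dist d phi r c (pt o s) < e%:E)%E ->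
    (weighted_dist rho G (@omega R) r t s < dl%:E)%E.
Proof.
move=> GG dl0; have [i i0 inj] := Gamma_injectivity_radius hdeck hcompact.
pose eta := i / 6; have eta0 : 0 < eta by rewrite divr_gt0.
have {}inj f x : agset Gamma f -> dP x (f x) < 6 * eta -> f = idfun.
  by move=> Gf; rewrite /eta mulrC divfK//; exact: inj.
have dl30 : 0 < dl / 3 by rewrite divr_gt0.
have [e e0 sep] := separation eta0 dl30.
exists e => // r c t s /hyperbolic_dist_lt[a1 ct] /hyperbolic_dist_lt[a2 cs].
(* The covering at [c] is turned so that the angle matching it with [t] becomes 0; [a] is the
   remaining angle for [s]. *)
pose a := a2 - a1.
pose X xi := phi c (rotation (- a1) xi).
have Xt xi : dP0 xi <= r -> (d (X xi) (pt xi t) < e%:E)%E.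
  move=> xir; have := ct (rotation (- a1) xi).
  by rewrite dP_rotation0 rotationD subrr rotation0; apply.
have Xs xi : dP0 xi <= r -> (d (X xi) (pt (rotation a xi) s) < e%:E)%E.
  by move=> xir; have := cs (rotation (- a1) xi); rewrite dP_rotation0 rotationD; apply.
(* Both [[xi, t]] and [[e^(ia) xi, s]] lie in one box of radius [eta], so [xi] and [e^(ia) xi] are
   within [2 * eta] modulo [Gamma]; [rotation_small] then removes the element of [Gamma]. *)
have rot : forall xi, dP0 xi <= r -> dP xi (rotation a xi) < 2 * eta.
  apply: rotation_small => // xi xir.
  have [z0 [t0 [_ near0]]] := sep (X xi).
  have [z [u [/esym/susp_pt_eq[f Gf [fxi _]] z0z _]]] := near0 _ (Xt xi xir).
  have [w [v [/esym/susp_pt_eq[h Gh [hxi _]] z0w _]]] := near0 _ (Xs xi xir).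
  have [f' Gf' [fK f'K]] := GammaV Gf.
  exists (f' \o h); first exact: GammaM.
  rewrite -(dP_Gamma _ _ Gf) /= f'K fxi hxi.
  apply: le_lt_trans (dP_triangle z0 _ _) _.
  by rewrite (dPC z z0); lra.
have wd k (g : 'I_k -> disk R -> disk R) : (forall j, G (g j)) ->
    \sum_(j < k) omega (g j) <= r ->
    mdist (rho (word g) t) (rho (word g) s) < dl / 3 + dl / 3.
  move=> Gg gr; have Gw := word_Gamma GG Gg.
  have [v Gv [wK vK]] := GammaV Gw.
  pose xi := v o.
  have xir : dP0 xi <= r.
    apply: le_trans gr; rewrite -dP0_dP -(dP_Gamma _ _ Gw) /xi vK dPC dP0_dP.
    exact: dP0_word GG Gg.
  have [z0 [t0 [z0min near0]]] := sep (X xi).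
  pose z := word g (rotation a xi).
  have oz : dP o z < 2 * eta by rewrite /z -{1}(vK o) (dP_Gamma _ _ Gw); exact: rot.
  have := near0 _ (Xt xi xir); have := near0 _ (Xs xi xir).
  rewrite -(susp_pt_act rho _ _ Gw) -[pt xi t](susp_pt_act rho _ _ Gw) /xi vK -/xi -/z.
  move=> [z2 [u2 [/esym/susp_pt_eq[h Gh [hz hu]] d2 m2]]].
  move=> [z1 [u1 [/esym/susp_pt_eq[f Gf [fo fu]] d1 m1]]].
  have [f' Gf' [fK f'K]] := GammaV Gf.
  (* A translate of [z0] is within [eta] of the origin, so the choice of representative in
     [separation] makes [z0] itself close to it. *)
  have z0small : dP0 z0 < 2 * eta.
    apply: (z0min f' Gf'); rewrite -dP0_dP -(dP_Gamma _ _ Gf) f'K fo dPC.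
    by lra.
  (* The elements [f] and [h] displace the origin by less than [3 * eta] and [5 * eta]. Both being
     trivial, [u1] and [u2] are the images of [t] and [s] under [rho (word g)]. *)
  have fid : f = idfun.
    apply: (inj f o Gf); apply: le_lt_trans (dP_triangle z0 _ _) _.
    by rewrite dP0_dP fo; lra.
  have hid : h = idfun.
    apply: (inj h o Gh); apply: le_lt_trans (dP_triangle z0 _ _) _.
    have := dP_triangle (h z) z0 (h o).
    by move: oz; rewrite (dP_Gamma _ _ Gh) hz (dPC z o) !dP0_dP; lra.
  rewrite fid rep_id /= in fu; rewrite hid rep_id /= in hu.
  rewrite fu hu; apply: le_lt_trans (metric_triangle _ t0 _) _.
  by rewrite (metric_sym u1 t0); exact: ltrD.
(* Thirds leave room for the supremum, which need only be bounded by two of them. *)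
apply: (@le_lt_trans _ _ (dl / 3 + dl / 3)%:E); last by rewrite lte_fin; lra.
apply: ge_ereal_sup => _ [k [g [Gg gr ->]]].
by rewrite lee_fin ltW// wd.
Qed.

(** A Lebesgue number, for the maximum metric, of a cover of a compact product by sets on whose
    images [d] stays below [e]; hence [dl] does not depend on [z]. *)
Lemma susp_pt_uniform (D e : R) : 0 < e ->
  exists2 dl : R, 0 < dl & forall z t s, dP0 z <= D -> mdist t s < dl ->
    (d (pt z t) (pt z s) < e%:E)%E.
Proof.
move=> e0; have [K cK KP] := dP0_ball_precompact D.
pose d' (p q : disk R * T) := (Num.max (dP p.1 q.1) (mdist p.2 q.2))%:E.
have exU (p : disk R * T) : exists U, nbhs (pt p.1 p.2) U /\
    forall y y', U y -> U y' -> (d y y' < e%:E)%E.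
  by have [V pV Vd] := d_small (pt p.1 p.2) e0; exists V.
have [U UP] := choice exU.
pose V p := [set q : disk R * T | U p (pt q.1 q.2)].
have basis (p : disk R * T) (B : set (disk R * T)) : nbhs p B ->
    exists2 r : R, 0 < r & forall q, (d' p q < r%:E)%E -> B q.
  case: p => z t [[B1 B2] /= [/disk_nbhsP[r1 r10 rB1] /nbhs_ballP[r2 /= r20 rB2]] B12].
  exists (Num.min r1 r2); first by rewrite lt_min r10.
  move=> [w s]; rewrite lte_fin gt_max !lt_min /= => /andP[/andP[zw _] /andP[_ ts]].
  by apply: B12; split; [exact: rB1|apply: rB2; rewrite ballEmdist].
have d'tri p q q' : (d' p q' <= d' p q + d' q q')%E.
  rewrite -EFinD lee_fin ge_max; apply/andP; split.
    by apply: le_trans (dP_triangle q.1 _ _) _; apply: lerD; rewrite le_max lexx.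
  by apply: le_trans (metric_triangle _ q.2 _) _; apply: lerD; rewrite le_max lexx orbT.
have d'near p (r : R) : 0 < r -> \forall q \near p, (d' p q < r%:E)%E.
  move=> r0; case: p => z t.
  exists ([set w | dP z w < r], [set s | mdist t s < r]); last first.
    by move=> [w s] /= [zw ts]; rewrite lte_fin gt_max zw.
  split => /=; last exact: mdist_nbhs.
  by apply/disk_nbhsP; exists r.
have [dl dl0 dlP] := lebesgue_number (V := V) (compact_setX cK hT) d'tri d'near
  (fun p _ => basis p (V p) (susp_pt_continuous (UP p).1)).
exists dl => // z t s zD ts.
have [|p [_ Vp Vd]] := dlP (z, t); first by split => //; exact: KP.
apply: (UP p).2; first exact: Vp.
by apply: (Vd (z, s)); rewrite lte_fin gt_max /= dPxx dl0.
Qed.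

Lemma hyperbolic_dist_lt_of_weighted (G : set (disk R -> disk R)) (D W e : R) :
  G `<=` agset Gamma -> 0 < e ->
  (forall r x, 0 <= r -> dP0 x <= r ->
    exists2 f, weighted_word G (@omega R) (W * (r + 1)) f & dP0 (f x) <= D) ->
  exists2 dl : R, 0 < dl & forall r t s, 0 < r ->
    (weighted_dist rho G (@omega R) (W * (r + 1)) t s < dl%:E)%E ->
    (hyperbolic_dist d phi r (pt o t) (pt o s) < e%:E)%E.
Proof.
move=> GG e0 WP; have e20 : 0 < e / 2 by rewrite divr_gt0.
have [dl dl0 dlP] := susp_pt_uniform D e20.
exists dl => // r t s r0 wts.
apply: (@le_lt_trans _ _ (e / 2)%:E); last by rewrite lte_fin; lra.
apply: hyperbolic_dist_le => xi xir.
have [f [k [g [Gg gr fE]]] fD] := WP r xi (ltW r0) xir.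
have Gf : agset Gamma f by rewrite fE; exact: word_Gamma Gg.
rewrite -(susp_pt_act rho _ t Gf) -(susp_pt_act rho _ s Gf); apply/ltW/dlP => //.
rewrite -lte_fin; apply: le_lt_trans wts; apply: ereal_sup_ubound.
by exists k, g; rewrite fE.
Qed.

Lemma weighted_entropy_le_hyperbolic (G : set (disk R -> disk R)) :
  G `<=` agset Gamma ->
  (weighted_entropy rho G (@omega R) <=
     hyperbolic_entropy d phi (transversal0 rho))%E.
Proof.
move=> GG; apply: entropy_le => dl dl0.
have [e e0 eP] := weighted_dist_lt_of_hyperbolic GG dl0.
exists e => // r _; apply: covering_number_le => k c cover.
have [[t0 _]|T0] := pselect (exists t : T, True); last first.
  (* With [T] empty the suspension is empty as well, so the existence of a centre [c i] is
     contradictory. *)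
  have c' : 'I_k -> T.
    move=> i; exfalso; have [z [t _]] := susp_pt_surj (c i).
    by apply: T0; exists t.
  by exists c' => t; exfalso; apply: T0; exists t.
(* Centres may lie off the transversal: a ball meeting it receives some [u] with [[0, u]] inside it,
   any other ball the default [t0]. *)
have ex_close i : exists u, forall t,
    (hyperbolic_dist d phi r (c i) (pt o t) < e%:E)%E ->
    (hyperbolic_dist d phi r (c i) (pt o u) < e%:E)%E.
  have [[u ui]|nu] := pselect (exists u, (hyperbolic_dist d phi r (c i) (pt o u) < e%:E)%E).
    by exists u.
  by exists t0 => t ti; exfalso; apply: nu; exists t.
have [c' c'P] := choice ex_close.
exists c' => t _; have [|i _ ti] := cover (pt o t); first by exists t.
by exists i => //=; exact: eP (c'P i t ti) ti.
Qed.

Lemma hyperbolic_entropy_le_weighted (G : set (disk R -> disk R)) (D W : R) :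
  G `<=` agset Gamma -> 0 < W ->
  (forall r x, 0 <= r -> dP0 x <= r ->
    exists2 f, weighted_word G (@omega R) (W * (r + 1)) f & dP0 (f x) <= D) ->
  (hyperbolic_entropy d phi (transversal0 rho) <=
     (2 * W)%R%:E * weighted_entropy rho G (@omega R))%E.
Proof.
move=> GG W0 WP.
have [[t0 _]|T0] := pselect (exists t : T, True); last first.
  rewrite /hyperbolic_entropy (_ : transversal0 rho = set0) ?entropy_set0 ?leNye//.
  by rewrite -subset0 => x [t _ _]; apply: T0; exists t.
apply: entropy_le_scale => //; first by exists t0.
move=> e e0; have [dl dl0 dlP] := hyperbolic_dist_lt_of_weighted GG e0 WP.
exists dl => // r r0; apply: covering_number_le => k c cover.
exists (fun i => pt o (c i)) => _ [t _ <-].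
by have [i _ ti] := cover t I; exists i => //=; exact: dlP.
Qed.

End separation.

(** * The distance induced on the suspension *)

Section induced_topology.
Context (R : realType) (X M : topologicalType) (n : nat).
Context (A : smooth_manifold R n M) (g : riemannian_metric A) (iota : X -> M).
Hypothesis emb : is_embedding iota.

Lemma embedded_dist_small (x : X) (e : R) : 0 < e ->
  exists2 V, nbhs x V &
    forall y y', V y -> V y' -> (riemannian_dist g (iota y) (iota y') < e%:E)%E.
Proof.
move=> /(riemannian_dist_small g (iota x))[V iV Vd]; exists (iota @^-1` V).
  move: iV; rewrite nbhsE => -[U [oU Ux] UV].
  apply: filterS (preimage_subset UV) _; apply: open_nbhs_nbhs; split => //.
  by apply/(emb.2); exists U.
by move=> y y'; exact: Vd.
Qed.

Lemma embedded_dist_ball (x : X) (V : set X) : nbhs x V ->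
  exists2 e : R, 0 < e &
    forall y, (riemannian_dist g (iota x) (iota y) < e%:E)%E -> V y.
Proof.
rewrite nbhsE => -[U [oU Ux] UV]; have [W oW UW] := (emb.2 U).1 oU.
have xW : nbhs (iota x) W.
  by apply: open_nbhs_nbhs; split => //; move: Ux; rewrite UW.
have [e e0 eW] := riemannian_dist_ball g xW.
by exists e => // y /eW Wy; apply: UV; rewrite UW.
Qed.

End induced_topology.

Theorem theorem4p10 (R : realType) (Gamma : aut_subgroup R)
    (hdeck : deck_action Gamma)
    (hcompact : compact [set: surface Gamma]%classic)
    (genus : nat) (hgenus : has_genus Gamma genus) (hgenus2 : (2 <= genus)%N)
    (G : set (disk R -> disk R)) (hG : symmetric_generators Gamma G)
    (hid : ~ G idfun) :
  exists K' : R,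
    forall (T : metricType R) (hT : compact [set: T]%classic)
      (rho : representation Gamma T)
      (n : nat) (M : topologicalType) (A : smooth_manifold R n M)
      (g : riemannian_metric A)
      (iota : suspension rho -> M) (hiota : hermitian_embedding g iota)
      (phi : suspension rho -> disk R -> suspension rho)
      (hphi : forall x, leaf_covering (phi x) x),
    let h_rho := weighted_entropy rho G (@omega R) in
    let h_T0 :=
      hyperbolic_entropy (induced_dist g iota) phi (transversal0 rho) in
    (h_rho <= h_T0 /\ h_T0 <= K'%:E * h_rho)%E.
Proof.
(* [W] is obtained from [Gamma] and [G] before [T] and [rho] are introduced, whence the uniformity
   of the constant. *)
have [D [W [W0 WP]]] := short_word_to_core hcompact hG.
exists (2 * W) => T hT rho n M A g iota [emb _] phi hphi h_rho h_T0.
have [_ GG _ _] := hG; rewrite {}/h_rho {}/h_T0.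
have tri (x y z : suspension rho) : (induced_dist g iota x z <=
    induced_dist g iota x y + induced_dist g iota y z)%E.
  exact: riemannian_dist_triangle.
split.
- exact: (weighted_entropy_le_hyperbolic hdeck hcompact hT tri
    (embedded_dist_small g emb) (embedded_dist_ball g emb) hphi GG).
- exact: (hyperbolic_entropy_le_weighted hT
    (embedded_dist_small g emb) hphi GG W0 WP).
Qed.
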